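(* Let $\mathbb{G}$ be a homogeneous, orientation preserving self-affine carpet with attractor $\Lambda$ and contraction ratios $0<r_1<r_2<1$, satisfying the rectangular open set condition and such that $\mathrm{p}_2\mathbb{G}$ satisfies the weak separation condition. Then $$\dim_{\mathrm H}(\Lambda)=\lim_{n\to\infty}\frac{\log\left(\sum_{T\in\mathrm{p}_2\mathbb{G}_n}\big(\#\{S\in\mathbb{G}_n:\mathrm{p}_2S=T\}\big)^{\frac{\log r_2}{\log r_1}}\right)}{-n\log r_2}.$$
   Context: A self-affine carpet is a finite set $\mathbb{G}$ of maps $S(x,y)=(r_{S,1}x+t_{S,1},\,r_{S,2}y+t_{S,2})$ of $\mathbb{R}^2$ with $|r_{S,\ell}|\in(0,1)$. Its attractor $\Lambda$ is the unique non-empty compact set with $\Lambda=\bigcup_{S\in\mathbb{G}}S(\Lambda)$. Write $\mathrm{p}_1(x,y)=x$, $\mathrm{p}_2(x,y)=y$; for a map $S$ of the form $S(x,y)=(r_{S,1}x+t_{S,1},\,r_{S,2}y+t_{S,2})$ with $|r_{S,\ell}|\in(0,1)$, $\mathrm{p}_\ell S$ is the map $u\mapsto r_{S,\ell}u+t_{S,\ell}$ of $\mathbb{R}$. For a finite set $\mathbb{F}$ of such maps, $\mathrm{p}_\ell\mathbb{F}=\{\mathrm{p}_\ell S:S\in\mathbb{F}\}$ as a set. Standing assumption: $\mathrm{conv}(\mathrm{p}_1\Lambda)\times\mathrm{conv}(\mathrm{p}_2\Lambda)=[0,1]^2$. $\mathbb{G}_n=\{S_1\circ\dots\circ S_n:S_i\in\mathbb{G}\}$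 as a set of maps. Homogeneous: there are positive reals $r_1,r_2$ with $r_{S,1}=r_1$, $r_{S,2}=r_2$ for all $S\in\mathbb{G}$. Orientation preserving: all $r_{S,\ell}>0$. Rectangular open set condition: $S((0,1)^2)\cap\hat S((0,1)^2)=\emptyset$ for all $S\ne\hat S\in\mathbb{G}$. A self-similar IFS $\mathbb{F}$ satisfies the weak separation condition if the identity map is an isolated point of $\{S^{-1}\circ\hat S:S,\hat S\in\mathbb{F}^*\}$, where $\mathbb{F}^*$ is the set of all finite compositions (of length $\geq 1$) of maps of $\mathbb{F}$. *)

(* Defs.v *)
From mathcomp Require Import all_boot all_order all_algebra.
From mathcomp Require Import finmap.
From mathcomp Require Import all_classical all_reals all_analysis.
From mathcomp Require Import ring lra.
Import Order.TTheory GRing.Theory Num.Theory.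
Import numFieldNormedType.Exports.

Set Implicit Arguments.
Unset Strict Implicit.
Unset Printing Implicit Defensive.

Local Open Scope fset_scope.
Local Open Scope classical_set_scope.
Local Open Scope ring_scope.

(* The map u |-> r * u + t of the line is encoded by the pair (r, t).  As such
   maps are determined by their coefficients ([aeval_inj] below), a set of
   pairs is the same thing as a set of maps, and the product topology on pairs
   is the usual topology on affine maps (pointwise convergence). *)
Definition amap (R : realType) : Type := (R * R)%type.

Definition ratio (R : realType) (f : amap R) : R := f.1.
Definition transl (R : realType) (f : amap R) : R := f.2.
Definition aeval (R : realType) (f : amap R) (u : R) : R :=
  ratio f * u + transl f.

Definition aid (R : realType) : amap R := (1, 0).
Definition acomp (R : realType) (f g : amap R) : amap R :=
  (ratio f * ratio g, ratio f * transl g + transl f).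
(* Only meaningful when [ratio f != 0]. *)
Definition ainv (R : realType) (f : amap R) : amap R :=
  ((ratio f)^-1, - (transl f / ratio f)).

Lemma aeval_inj (R : realType) (f g : amap R) : aeval f = aeval g -> f = g.
Proof.
move=> fg; have := congr1 (@^~ 0) fg; have := congr1 (@^~ 1) fg.
by case: f {fg} => a b; case: g => c d; rewrite /aeval/ratio/transl/= => *; congr pair; lra.
Qed.

Lemma aeval_id (R : realType) : aeval (aid R) = id.
Proof. by apply/funext => u; rewrite /aeval/ratio/transl/=; ring. Qed.

Lemma aeval_comp (R : realType) (f g : amap R) :
  aeval (acomp f g) = aeval f \o aeval g.
Proof. by apply/funext => u; rewrite /aeval/acomp/ratio/transl/=; ring. Qed.

Lemma aeval_inv (R : realType) (f : amap R) : ratio f != 0 ->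
  cancel (aeval f) (aeval (ainv f)) /\ cancel (aeval (ainv f)) (aeval f).
Proof.
by rewrite /cancel/aeval/ainv/ratio/transl/= => f0; split=> u; field.
Qed.

(* The map S(x, y) = (r1 x + t1, r2 y + t2) of the plane is encoded by the pair
   of its coordinate maps, so that p_1 S and p_2 S are [S.1] and [S.2]. *)
Definition cmap (R : realType) : Type := (amap R * amap R)%type.

Definition ceval (R : realType) (S : cmap R) (z : R * R) : R * R :=
  (aeval S.1 z.1, aeval S.2 z.2).
Definition cid (R : realType) : cmap R := (aid R, aid R).
Definition ccomp (R : realType) (S T : cmap R) : cmap R :=
  (acomp S.1 T.1, acomp S.2 T.2).

Lemma ceval_inj (R : realType) (S T : cmap R) : ceval S = ceval T -> S = T.
Proof.
move=> ST; rewrite [S]surjective_pairing [T]surjective_pairing.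
congr pair; apply/aeval_inj/funext => u.
- by have := congr1 (fun f => (f (u, 0)).1) ST.
- by have := congr1 (fun f => (f (0, u)).2) ST.
Qed.

Lemma ceval_id (R : realType) : ceval (cid R) = id.
Proof. by apply/funext => -[x y]; rewrite /ceval/= aeval_id. Qed.

Lemma ceval_comp (R : realType) (S T : cmap R) :
  ceval (ccomp S T) = ceval S \o ceval T.
Proof. by apply/funext => -[x y]; rewrite /ceval/= !aeval_comp. Qed.

(* The set of all products of n elements of F; [words op e F 0 = {e}]. *)
Fixpoint words (K : choiceType) (op : K -> K -> K) (e : K) (F : {fset K})
    (n : nat) : {fset K} :=
  if n is m.+1 then [fset op S W | S in F, W in words op e F m] else [fset e].

Definition level (R : realType) (G : {fset cmap R}) (n : nat) :
  {fset cmap R} := words (@ccomp R) (cid R) G n.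

Definition proj_ifs2 (R : realType) (G : {fset cmap R}) : {fset amap R} :=
  [fset S.2 | S in G].

Definition star (R : realType) (F : {fset amap R}) : set (amap R) :=
  [set f | exists2 n, (0 < n)%N & f \in words (@acomp R) (aid R) F n].

Definition weak_separation (R : realType) (F : {fset amap R}) : Prop :=
  isolated [set acomp (ainv f) g | f in star F & g in star F]
    (aid R : (R * R)%type).

Definition self_affine_carpet (R : realType) (G : {fset cmap R}) : Prop :=
  forall S, S \in G -> 0 < `|ratio S.1| < 1 /\ 0 < `|ratio S.2| < 1.

Definition is_attractor (R : realType) (G : {fset cmap R})
    (L : set (R * R)) : Prop :=
  [/\ L !=set0, compact L & L = \bigcup_(S in [set` G]) (ceval S @` L)].

Definition convex_hull (R : realType) (A : set R) : set R :=
  smallest (@convex_set R R^o) A.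

Definition normalized (R : realType) (L : set (R * R)) : Prop :=
  convex_hull (fst @` L) `*` convex_hull (snd @` L) =
  `[0, 1]%classic `*` `[0, 1]%classic.

Definition homogeneous (R : realType) (G : {fset cmap R}) (r1 r2 : R) : Prop :=
  [/\ 0 < r1, 0 < r2 &
      forall S, S \in G -> ratio S.1 = r1 /\ ratio S.2 = r2].

Definition orientation_preserving (R : realType) (G : {fset cmap R}) : Prop :=
  forall S, S \in G -> 0 < ratio S.1 /\ 0 < ratio S.2.

Definition rectangular_osc (R : realType) (G : {fset cmap R}) : Prop :=
  forall S T, S \in G -> T \in G -> S <> T ->
    (ceval S @` (`]0, 1[ `*` `]0, 1[)) `&` (ceval T @` (`]0, 1[ `*` `]0, 1[))
    = set0.

(* The library's norm on R * R is the max norm, hence an explicit distance. *)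
Definition eucl_dist (R : realType) (p q : R * R) : R :=
  Num.sqrt ((p.1 - q.1) ^+ 2 + (p.2 - q.2) ^+ 2).

(* -oo on the empty set *)
Definition diam (R : realType) (U : set (R * R)) : \bar R :=
  ereal_sup [set (eucl_dist p q)%:E | p in U & q in U].

(* diam(U)^s, with the conventions diam(set0)^s = 0 and 0^0 = 1 otherwise. *)
Definition diam_pow (R : realType) (s : R) (U : set (R * R)) : \bar R :=
  if U == set0 then 0%E else poweR (diam U) s.

Definition hausdorff_premeasure (R : realType) (s delta : R)
    (E : set (R * R)) : \bar R :=
  ereal_inf [set (\sum_(0 <= i <oo) diam_pow s (U i))%E |
    U in [set U : nat -> set (R * R) |
      E `<=` \bigcup_i U i /\ forall i, (diam (U i) <= delta%:E)%E]].

Definition hausdorff_measure (R : realType) (s : R) (E : set (R * R)) :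
    \bar R :=
  ereal_sup [set hausdorff_premeasure s delta E | delta in [set d | 0 < d]].

Definition hausdorff_dim (R : realType) (E : set (R * R)) : \bar R :=
  ereal_inf [set s%:E | s in
    [set s : R | 0 <= s /\ hausdorff_measure s E = 0%E]].

(* Main.v *)
Require Import Defs.
From mathcomp Require Import all_boot all_order all_algebra.
From mathcomp Require Import finmap.
From mathcomp Require Import all_classical all_reals all_analysis.
From mathcomp Require Import ring lra zify.
Import Order.TTheory GRing.Theory Num.Theory.
Import numFieldNormedType.Exports.

(** Put theta = ln r2 / ln r1 < 1, let N_n(T) be the number of S in G_n with
    p_2 S = T, and let Z_n be the sum in the theorem.  With
    a_n = ln Z_n / (- n ln r2), the dimension lies between a_n - o(1) and a_n
    for every n > 0.

    Upper bound.  As s |-> s^theta is subadditive, Z_(n+m) <= Z_n Z_m, so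
    Z_k = O(exp (k ln Z_n / n)) for each fixed n.
    Take scales k_(j+1) ~ k_j / theta, so that a rectangle of width r1^k_j and
    height r2^k_(j+1) is almost a square.  For a point of the attractor with
    prefixes P_k, the averages ln N_k(p_2 P_k) / k of the fibre counts are
    bounded, so they cannot drop substantially at each of boundedly many
    successive scales.  At a scale without drop, the rectangle around the
    point has large weight N_k^theta / N_l, and weak separation bounds the total
    weight of the rectangles by a multiple of Z_k; hence few rectangles are
    needed.

    Lower bound.  By the pigeonhole principle on the dyadic size of the fibres,
    and by weak separation, G_n contains a subsystem of [a] disjoint rows with
    exactly [b] maps each, where [a * b^theta >= Z_n / O(n)].  Words over such a
    uniform subsystem are counted near a point by counting the row words and
    the words inside one row separately, and this gives the dimension
    (ln a + theta ln b) / (- n ln r2) without constructing a measure. *)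

Set Implicit Arguments.
Unset Strict Implicit.
Unset Printing Implicit Defensive.

Local Open Scope fset_scope.
Local Open Scope classical_set_scope.
Local Open Scope ring_scope.

(* Both names are shadowed by MathComp's. *)
Local Notation ratio := Defs.ratio.
Local Notation cid := Defs.cid.

(** * Hausdorff measure: criteria by finite covers *)

(** A number in [[0, 1]] is at most its own [s]-th power; this is applied to the fractions
    [x / (x + y)] and [y / (x + y)], which add up to 1. *)
Lemma powRD_le (R : realType) (s x y : R) : 0 < s -> s <= 1 -> 0 <= x -> 0 <= y ->
  (x + y) `^ s <= x `^ s + y `^ s.
Proof.
move=> s0 s1 x0 y0.
have [xy0|xy0] := eqVneq (x + y) 0.
  by rewrite xy0 powR0 ?gt_eqF// addr_ge0 ?powR_ge0.
have xy_gt0 : 0 < x + y by rewrite lt_neqAle eq_sym xy0 addr_ge0.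
have key z : 0 <= z -> z <= x + y -> z / (x + y) * (x + y) `^ s <= z `^ s.
  move=> z0 zxy; have a01 : 0 <= z / (x + y) <= 1.
    by rewrite divr_ge0// ?ler_pdivrMr ?mul1r// ltW.
  rewrite -[in leRHS](divfK xy0 z) powRM ?(ltW xy_gt0)//; last by case/andP: a01.
  rewrite ler_wpM2r ?powR_ge0// -[leLHS]powRr1; last by case/andP: a01.
  have [->|zn0] := eqVneq (z / (x + y)) 0; first by rewrite !powR0 ?gt_eqF.
  by apply: ger_powR => //; case/andP: a01 => a0 ->; rewrite lt_neqAle eq_sym zn0 a0.
have -> : (x + y) `^ s = x / (x + y) * (x + y) `^ s + y / (x + y) * (x + y) `^ s.
  by rewrite -mulrDl -mulrDl divff// mul1r.
by rewrite lerD// key// ?lerDl ?lerDr.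
Qed.

Lemma powR_sum_le (R : realType) (I : Type) (r : seq I) (P : pred I)
    (F : I -> R) (s : R) : 0 < s -> s <= 1 -> (forall i, P i -> 0 <= F i) ->
  (\sum_(i <- r | P i) F i) `^ s <= \sum_(i <- r | P i) F i `^ s.
Proof.
move=> s0 s1 F0.
suff [] : (\sum_(i <- r | P i) F i) `^ s <= \sum_(i <- r | P i) F i `^ s /\
  0 <= \sum_(i <- r | P i) F i by [].
elim/big_rec2: _ => [|i y1 y2 Pi [le y20]]; first by rewrite powR0 ?gt_eqF.
split; last by rewrite addr_ge0 ?F0.
by rewrite (le_trans (powRD_le s0 s1 (F0 _ Pi) y20))// lerD2l.
Qed.

(** Cut [[u, v]] into cells of length [d]: no cell receives two values of [f]. This packing bound
    serves both digit expansions and weak separation. *)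
Lemma size_separated (R : realType) (T : eqType) (s : seq T) (f : T -> R)
    (u v d : R) : 0 < d -> u <= v -> uniq s ->
  (forall x, x \in s -> u <= f x <= v) ->
  {in s &, forall x y, x != y -> d <= `|f x - f y|} ->
  (size s)%:R <= (v - u) / d + 1.
Proof.
move=> d0 uv us fuv sep.
pose g x := Num.truncn ((f x - u) / d); pose N := Num.truncn ((v - u) / d).
have ge0 x : x \in s -> 0 <= (f x - u) / d.
  by move=> /fuv/andP[ux _]; rewrite divr_ge0 ?subr_ge0// ltW.
have ginj : {in s &, injective g}.
  move=> x y xs ys gxy; apply/eqP/negPn/negP => /(sep _ _ xs ys).
  have /andP[x1 x2] := truncn_itv (ge0 _ xs).
  have /andP[y1 y2] := truncn_itv (ge0 _ ys).
  move: x1 x2; rewrite -/(g x) gxy => x1 x2; apply/negP; rewrite -ltNge.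
  have -> : f x - f y = ((f x - u) / d - (f y - u) / d) * d by field; rewrite gt_eqF.
  rewrite normrM (gtr0_norm d0) gtr_pMl// ltr_norml; move: x1 x2 y1 y2.
  rewrite -/(g y) -natr1; lra.
have le : (size s <= N.+1)%N.
  rewrite -(size_map g) -(size_iota 0 N.+1); apply: uniq_leq_size.
    by rewrite map_inj_in_uniq.
  move=> _ /mapP[x xs ->]; rewrite mem_iota add0n ltnS /=.
  apply: le_truncn; rewrite ler_pM2r ?invr_gt0// lerD2r.
  by have /andP[] := fuv _ xs.
apply: (le_trans (y := N.+1%:R)); first by rewrite ler_nat.
by rewrite -natr1 lerD2r truncn_le divr_ge0 ?subr_ge0// ltW.
Qed.

Section hausdorff.
Variable R : realType.
Implicit Types (s t : R) (E U : set (R * R)).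

Lemma diam_ge0 U : U !=set0 -> (0 <= diam U)%E.
Proof.
move=> [p Up]; apply: ereal_sup_ubound => /=.
by exists p => //; exists p => //; rewrite /eucl_dist !subrr expr0n/= addr0 sqrtr0.
Qed.

Lemma diam0 : diam (set0 : set (R * R)) = -oo%E.
Proof.
rewrite /diam (_ : [set _ | _ in _ & _ in _] = set0) ?ereal_sup0//.
by rewrite -subset0 => _ [p []].
Qed.

Lemma diam_le U (h : R) :
  (forall p q, U p -> U q -> eucl_dist p q <= h) -> (diam U <= h%:E)%E.
Proof.
by move=> Uh; apply: ge_ereal_sup => _ /= [p Up [q Uq <-]]; rewrite lee_fin Uh.
Qed.

Lemma eucl_dist_le_sup (p q : R * R) (h : R) :
  `|p.1 - q.1| <= h -> `|p.2 - q.2| <= h -> eucl_dist p q <= 2 * h.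
Proof.
move=> h1 h2; have h0 : 0 <= h by apply: le_trans h1.
rewrite /eucl_dist -(@ler_sqr R) ?nnegrE ?sqrtr_ge0 ?mulr_ge0//.
rewrite sqr_sqrtr ?addr_ge0 ?sqr_ge0//.
move: h1 h2; rewrite !ler_norml => /andP[? ?] /andP[? ?]; nra.
Qed.

Lemma eucl_dist_ge_sup (p q : R * R) :
  `|p.1 - q.1| <= eucl_dist p q /\ `|p.2 - q.2| <= eucl_dist p q.
Proof.
rewrite /eucl_dist -!sqrtr_sqr !ler_wsqrtr//.
- by rewrite lerDr sqr_ge0.
- by rewrite lerDl sqr_ge0.
Qed.

Lemma diam_pow_ge0 s U : (0 <= diam_pow s U)%E.
Proof. by rewrite /diam_pow; case: ifP => // _; exact: poweR_ge0. Qed.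

Lemma diam_pow_le s U (h : R) : 0 < s -> 0 <= h -> (diam U <= h%:E)%E ->
  (diam_pow s U <= (h `^ s)%:E)%E.
Proof.
move=> s0 h0 Uh; rewrite /diam_pow; case: ifPn => [_|/set0P U0].
  by rewrite lee_fin powR_ge0.
have := diam_ge0 U0; case: (diam U) Uh => // d; rewrite !lee_fin => dh d0.
by rewrite ge0_ler_powR ?nnegrE// ltW.
Qed.

(** A finite cover becomes a sequence by padding with empty sets, which cost nothing by the
    convention in [diam_pow]. Covering is stated through positions in [A], so that [I] can be any
    type. *)
Lemma hausdorff_measure_eq0 s E : 0 < s ->
  (forall d e : R, 0 < d -> 0 < e ->
    exists (I : Type) (A : seq I) (U : I -> set (R * R)) (h : I -> R),
    [/\ forall i, 0 <= h i <= d, forall i, (diam (U i) <= (h i)%:E)%E,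
        forall z, E z -> exists2 n, (n < size A)%N & forall x0, U (nth x0 A n) z &
        \sum_(i <- A) h i `^ s <= e]) ->
  hausdorff_measure s E = 0%E.
Proof.
move=> s0 H; apply/eqP; rewrite eq_le; apply/andP; split; last first.
  apply: (@le_trans _ _ (hausdorff_premeasure s 1 E)).
    by apply: le_ereal_inf_tmp => _ [U _ <-]; apply: nneseries_ge0 => n _ _; exact: diam_pow_ge0.
  by apply: ereal_sup_ubound; exists 1 => //=.
apply: ge_ereal_sup => _ [d /= d0 <-].
apply/lee_addgt0Pr => e e0; rewrite add0e.
have [I [A [U [h [hd Uh EU Ah]]]]] := H d e d0 e0.
case: A EU Ah => [|x0 A'] EU Ah.
  apply: ge_ereal_inf; exists 0%E => /=; last by rewrite lee_fin ltW.
  exists (fun=> set0); first split.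
  - by move=> z /EU[].
  - by move=> i; rewrite diam0 leNye.
  by rewrite eseries0// => i _ _; rewrite /diam_pow eqxx.
set A := x0 :: A' in EU Ah.
pose V i := if (i < size A)%N then U (nth x0 A i) else set0.
apply: ge_ereal_inf; exists (\sum_(0 <= i <oo) diam_pow s (V i))%E => /=.
  exists V => //; split.
  - by move=> z /EU[n nA /(_ x0) Uz]; exists n => //; rewrite /V nA.
  - move=> i; rewrite /V; case: ifP => _.
      by rewrite (le_trans (Uh _))// lee_fin; have /andP[] := hd (nth x0 A i).
    by rewrite diam0 leNye.
rewrite (nneseries_split 0 (size A)) => [|k _]; last exact: diam_pow_ge0.
rewrite [X in (_ + X)%E]eseries0 ?adde0; last first.
  move=> i; rewrite add0n => Ai _.
  by rewrite /V ltnNge Ai/= /diam_pow eqxx.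
apply: (@le_trans _ _ (\sum_(i <- A) h i `^ s)%:E); last by rewrite lee_fin.
rewrite add0n -sumEFin (big_nth x0) !big_mkord; apply: lee_sum => i _.
rewrite /V ltn_ord; apply: diam_pow_le => //.
by have /andP[] := hd (nth x0 A i).
Qed.

End hausdorff.

(** * Positivity of Hausdorff measure of compact sets, tested on finite covers by squares *)

Section hausdorff_lower.
Variable R : realType.

Definition square (p : R * R) (r : R) : set (R * R) :=
  [set q | `|q.1 - p.1| < r /\ `|q.2 - p.2| < r].

Lemma open_square (p : R * R) (r : R) : open (square p r).
Proof.
suff -> : square p r = ball p r by exact: ball_open.
by apply/seteqP; split => q [q1 q2]; split; rewrite /= ?/ball/= distrC.
Qed.

Lemma geometric_sum_le1 (N : nat) : \sum_(i < N) (2^-1 : R) ^+ i.+1 <= 1.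
Proof.
suff -> : \sum_(i < N) (2^-1 : R) ^+ i.+1 = 1 - 2^-1 ^+ N.
  by rewrite lerBlDr lerDl exprn_ge0// invr_ge0.
elim: N => [|N IH]; first by rewrite big_ord0 expr0 subrr.
by rewrite big_ord_recr/= IH exprS; field.
Qed.

(** Null [t]-measure would give a cover whose [t]-th powers of diameters have a tiny sum. Enclosing
    its members in open squares and extracting a finite subcover yields an [F] whose sum of [s]-th
    powers is below [c]. *)
Lemma hausdorff_measure_neq0 (s t c : R) (E : set (R * R)) :
  compact E -> 0 < c -> 0 <= t -> t < s ->
  (forall F : seq ((R * R) * R), (forall x, x \in F -> 0 < x.2 <= 1) ->
    (forall z, E z -> exists2 x, x \in F & square x.1 x.2 z) ->
    c <= \sum_(x <- F) x.2 `^ s) ->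
  hausdorff_measure t E <> 0%E.
Proof.
move=> cE c0 t0 ts H E0.
have s0 : 0 < s by apply: le_lt_trans ts.
(* [A] is the price of radii that are twice the diameters. The choice of [e] gives
   [(A + 1) * e <= c / 2], and [e <= 1] keeps the radii of degenerate sets at most 1. *)
pose A : R := 2 `^ s; have A0 : 0 < A by rewrite powR_gt0.
pose e := Num.min 1 (c / (2 * (A + 1))).
have e0 : 0 < e by rewrite lt_min ltr01 divr_gt0// mulr_gt0// addr_gt0.
(* Diameters at most 1/2 make the radii [2 * d i] at most 1. *)
have : (hausdorff_premeasure t 2^-1 E < e%:E)%E.
  apply: (@le_lt_trans _ _ 0%E); last by rewrite lte_fin.
  by rewrite -E0; apply: ereal_sup_ubound; exists 2^-1 => //=; rewrite invr_gt0.
move=> /ereal_inf_lt[_ [U [EU dU] <-]] sumU.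
(* Empty members are discarded: their diameter is -oo, which [fine] would turn into 0. *)
pose D := [set i | U i !=set0].
pose d i := fine (diam (U i)).
(* The radii of degenerate covering sets have s-th powers of sum at most e. *)
pose r i := if d i == 0 then (e * 2^-1 ^+ i.+1) `^ s^-1 else 2 * d i.
have Ud i : D i -> diam (U i) = (d i)%:E /\ 0 <= d i <= 2^-1.
  move=> Di; have := diam_ge0 Di; have := dU i; rewrite /d.
  by case: (diam (U i)) => // x; rewrite !lee_fin => -> ->.
pose p i : R * R := xget (0, 0) (U i).
have pU i : D i -> U i (p i) by move=> Di; exact: xgetPex.
have ei (i : nat) : 0 < e * 2^-1 ^+ i.+1 <= 1.
  rewrite mulr_gt0 ?exprn_gt0 ?invr_gt0//=.
  by rewrite mulr_ile1 ?exprn_ge0 ?invr_ge0 ?(ltW e0)// ?ge_min ?lexx//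
    exprn_ile1 ?invr_ge0// invf_le1// ler1n.
have r01 i : D i -> 0 < r i <= 1.
  move=> /Ud[_ /andP[d0 d1]]; rewrite /r; have /andP[ei0 ei1] := ei i.
  case: ifPn => [_|dn0].
    rewrite powR_gt0//=; suff : (e * 2^-1 ^+ i.+1) `^ s^-1 <= 1 `^ s^-1 by rewrite powR1.
    by rewrite ge0_ler_powR ?nnegrE ?invr_ge0 ?(ltW s0) ?(ltW ei0).
  have {}dn0 : 0 < d i by rewrite lt_neqAle eq_sym dn0.
  by apply/andP; split; lra.
have UE i : D i -> U i `<=` square (p i) (r i).
  move=> Di q Uq; have [dUi /andP[d0 d1]] := Ud _ Di.
  have le : eucl_dist q (p i) <= d i.
    rewrite -lee_fin -dUi; apply: ereal_sup_ubound; exists q => //.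
    by exists (p i) => //; exact: pU.
  have lt : d i < r i.
    have := r01 _ Di; rewrite /r; case: ifPn => [/eqP->/andP[]//|dn0 _].
    by rewrite ltr_pMl ?ltr1n// lt_neqAle eq_sym dn0.
  by have [l1 l2] := eucl_dist_ge_sup q (p i); split; apply: le_lt_trans lt; apply: le_trans le.
have EC : E `<=` cover D (fun i => square (p i) (r i)).
  move=> z /EU[i _ Uz]; have Di : D i by exists z.
  by exists i => //; exact: UE.
have := congr1 (@^~ E) (@compact_cover ((R * R)%type : normedModType R)).
cbv beta => cE'; move: cE; rewrite [compact E]cE' => {cE'}.
move=> /(_ _ D (fun i => square (p i) (r i)))[|//|D' D'D ED'].
  by move=> i _; exact: open_square.
have := H [seq (p i, r i) | i <- D'].
have -> : \sum_(x <- [seq (p i, r i) | i <- D']) x.2 `^ s = \sum_(i <- D') r i `^ s.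
  by rewrite big_map.
apply/not_implyP; split.
  by move=> _ /mapP[i iD' ->]; apply: r01; have := D'D _ iD'; rewrite inE.
apply/not_implyP; split.
  move=> z /ED'[i iD' iz]; exists (p i, r i) => //.
  by apply/mapP; exists i.
apply/negP; rewrite -ltNge.
(* Every index of the finite subcover is below [N], so sums over [D'] are bounded by partial sums of
   the series. *)
pose N := (\max_(i <- D') i).+1.
have rle i : i \in D' -> r i `^ s <= A * d i `^ t + e * 2^-1 ^+ i.+1.
  move=> /D'D; rewrite inE => Di; have [_ /andP[d0 d1]] := Ud _ Di.
  rewrite /r; case: ifPn => [_|dn0].
    rewrite -powRrM mulVf ?gt_eqF// powRr1; last by case/andP: (ei i) => /ltW.
    by rewrite lerDr mulr_ge0 ?powR_ge0// ltW.
  rewrite powRM// -/A; apply: ler_wpDr; first by case/andP: (ei i) => /ltW.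
  rewrite ler_wpM2l ?(ltW A0)//; apply: ger_powR; last exact: ltW.
  rewrite lt_neqAle eq_sym dn0 d0/= (le_trans d1)//.
  by rewrite invf_le1// ler1n.
have sumle (f : nat -> R) : (forall i, 0 <= f i) ->
    \sum_(i <- D') f i <= \sum_(i < N) f i.
  move=> f0; rewrite -(big_mkord predT f) /index_iota subn0.
  have -> : \sum_(i <- D') f i = \sum_(i <- iota 0 N | i \in D') f i.
    rewrite -[RHS]big_filter; apply: perm_big; apply: uniq_perm.
    - exact: fset_uniq.
    - by rewrite filter_uniq// iota_uniq.
    - move=> i; rewrite mem_filter mem_iota/= add0n.
      apply/idP/andP => [iD|[]//]; split => //.
      by rewrite /N ltnS; exact: leq_bigmax_seq.
  by rewrite [leRHS](bigID (mem D'))/= lerDl sumr_ge0.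
apply: (@le_lt_trans _ _ (\sum_(i <- D') (A * d i `^ t + e * 2^-1 ^+ i.+1))).
  by rewrite big_seq [leRHS]big_seq; apply: ler_sum.
rewrite big_split/= -!mulr_sumr.
have l1 : \sum_(i <- D') d i `^ t <= e.
  rewrite -lee_fin; apply/ltW; apply: le_lt_trans sumU.
  apply: (@le_trans _ _ (\sum_(i < N) diam_pow t (U i))%E); last first.
    rewrite -(big_mkord predT (fun i => diam_pow t (U i))).
    by apply: nneseries_lim_ge => k _ _; exact: diam_pow_ge0.
  pose f i := if `[< D i >] then d i `^ t else 0.
  apply: (@le_trans _ _ (\sum_(i < N) f i)%:E).
    rewrite lee_fin; apply: le_trans (sumle f _).
      rewrite big_seq [leRHS]big_seq; apply: ler_sum => i /D'D; rewrite inE => Di.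
      by rewrite /f asboolT.
    by move=> i; rewrite /f; case: ifP => // _; exact: powR_ge0.
  rewrite -sumEFin; apply: lee_sum => i _; rewrite /f; case: asboolP => Di.
    rewrite /diam_pow ifF ?(Ud _ Di).1//.
    by apply/negP => /eqP UE0; move: Di; rewrite /D/= UE0 => -[].
  exact: diam_pow_ge0.
have l2 : \sum_(i <- D') (2^-1 : R) ^+ i.+1 <= 1.
  apply: le_trans (geometric_sum_le1 N); apply: sumle => i.
  by rewrite exprn_ge0// invr_ge0.
apply: (@le_lt_trans _ _ (A * e + e * 1)).
  by rewrite lerD// ler_wpM2l// ltW.
rewrite mulr1 -[X in _ + X]mul1r -mulrDl.
apply: (@le_lt_trans _ _ (c / 2)); last by lra.
rewrite mulrC -ler_pdivlMr ?addr_gt0//.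
by rewrite /e ge_min -mulrA -invfM lexx orbT.
Qed.

End hausdorff_lower.

(** * Counting digit expansions near a point *)

Section digits.
Variables (R : realType) (A : Type) (J : finType) (r : R) (c : A -> J -> R).
Hypotheses (r0 : 0 < r) (r1 : r < 1).
Hypothesis c_itv : forall a j, 0 <= c a j <= 1 - r.
Hypothesis c_sep : forall a j j', j != j' -> r <= `|c a j - c a j'|.

(* pos [:: a1; a2; ...] [:: j1; j2; ...] x = c a1 j1 + r * c a2 j2 + ... + r^K * x *)
Fixpoint pos (u : seq A) (js : seq J) (x : R) : R :=
  match u, js with
  | a :: u', j :: js' => r * pos u' js' x + c a j
  | _, _ => x
  end.

Lemma pos_cat (u1 u2 : seq A) (js1 js2 : seq J) (x : R) : size u1 = size js1 ->
  pos (u1 ++ u2) (js1 ++ js2) x = pos u1 js1 (pos u2 js2 x).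
Proof. by elim: u1 js1 => [|a u1 IH] [|j js1]//= [/IH->]. Qed.

Lemma pos_affine (u : seq A) (js : seq J) (x : R) : size u = size js ->
  pos u js x = r ^+ size u * x + pos u js 0.
Proof.
elim: u js => [|a u IH] [|j js]//=; first by rewrite expr0; lra.
by move=> [/IH->]; rewrite exprS; lra.
Qed.

Lemma pos_itv (u : seq A) (js : seq J) (x : R) : 0 <= x <= 1 ->
  0 <= pos u js x <= 1.
Proof.
move=> x01; elim: u js => [|a u IH] [|j js]//=.
have /andP[p0 p1] := IH js; have /andP[c0 c1] := c_itv a j.
have := mulr_ge0 (ltW r0) p0; have : r * pos u js x <= r * 1 by rewrite ler_pM2l.
by move=> ? ?; apply/andP; split; lra.
Qed.

(** Equal first digits reduce to the tails, scaled by [r]. Different first digits move the points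
    apart by at least [r], and the tails, which lie in [[0, 1 - r ^+ size u]] because their values
    at 1 are still at most 1, take back at most [r * (1 - r ^+ size u)]. *)
Lemma pos_sep (u : seq A) (js js' : seq J) : size u = size js ->
  size u = size js' -> js != js' ->
  r ^+ size u <= `|pos u js 0 - pos u js' 0|.
Proof.
elim: u js js' => [|a u IH] [|j js] [|j' js']//= [s1] [s2].
rewrite eqseq_cons negb_and exprS; have [->|jj' _] := eqVneq j j'.
  move=> /(IH _ _ s1 s2) le.
  rewrite [X in `|X|](_ : _ = r * (pos u js 0 - pos u js' 0)); last by ring.
  by rewrite normrM (gtr0_norm r0) ler_pM2l.
have := c_sep a jj'; have z01 : 0 <= (0 : R) <= 1 by rewrite lexx ler01.
have o01 : 0 <= (1 : R) <= 1 by rewrite lexx ler01.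
have /andP[p0 _] := pos_itv u js z01; have /andP[p0' _] := pos_itv u js' z01.
have /andP[_] := pos_itv u js o01; rewrite (pos_affine _ s1) mulr1 => p1.
have /andP[_] := pos_itv u js' o01; rewrite (pos_affine _ s2) mulr1 => p1'.
have : `|pos u js 0 - pos u js' 0| <= 1 - r ^+ size u.
  by rewrite ler_norml; apply/andP; split; lra.
set p := pos u js 0 - _ => ple cle.
rewrite [X in `|X|](_ : _ = (c a j - c a j') + r * p); last by rewrite /p; ring.
rewrite -[c a j - _]opprK -[r * p]opprK -opprD normrN.
apply: le_trans (lerB_dist _ _); rewrite !normrN normrM (gtr0_norm r0).
have : r * `|p| <= r * (1 - r ^+ size u) by rewrite ler_pM2l.
by lra.
Qed.

(** The first [l] digits place a cell of length [r ^+ l] that meets the window around [x], and left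
    ends of such cells are [r ^+ l]-separated. The last [m] digits are left free. *)
Lemma card_pos_near (l m : nat) (u : seq A) (x0 x rho : R) :
  size u = (l + m)%N -> 0 <= x0 <= 1 -> 0 < rho ->
  #|[set js : (l + m).-tuple J | `|pos u js x0 - x| < rho]%SET|%:R <=
    (2 * rho / r ^+ l + 2) * #|J|%:R ^+ m :> R.
Proof.
move=> su x01 rho0.
have h1 (js : (l + m).-tuple J) : size (take l js) == l.
  by rewrite size_takel// size_tuple leq_addr.
have h2 (js : (l + m).-tuple J) : size (drop l js) == m.
  by rewrite size_drop size_tuple addKn.
pose f js := (Tuple (h1 js), Tuple (h2 js)).
have f_inj : injective f.
  move=> js js' [e1 e2]; apply: val_inj => /=.
  by rewrite -[val js](cat_take_drop l) -[val js'](cat_take_drop l) e1 e2.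
have sl : size (take l u) = l by rewrite size_takel// su leq_addr.
pose V := [set v : l.-tuple J |
  x - rho - r ^+ l <= pos (take l u) v 0 <= x + rho]%SET.
have rl0 : 0 < r ^+ l by rewrite exprn_gt0.
have cardV : #|V|%:R <= 2 * rho / r ^+ l + 2.
  rewrite cardE.
  have -> : 2 * rho / r ^+ l + 2 = (x + rho - (x - rho - r ^+ l)) / r ^+ l + 1.
    by field; rewrite gt_eqF.
  apply: (@size_separated R _ (enum V) (fun v : l.-tuple J => pos (take l u) v 0)) => //.
  - lra.
  - exact: enum_uniq.
  - by move=> v; rewrite mem_enum inE.
  - move=> v v' _ _ vv'; rewrite -[in leLHS]sl.
    by apply: pos_sep; rewrite ?size_tuple.
set W := [set js | _]%SET.
have sub : (f @: W)%SET \subset finset.setX V [set: m.-tuple J]%SET.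
  apply/fintype.subsetP => _ /imsetP[js + ->]; rewrite !inE andbT /= => near.
  have s1 : size (take l u) = size (take l js) by rewrite sl (eqP (h1 js)).
  have := near; rewrite -[in pos _ _](cat_take_drop l u) -[in pos _ _](cat_take_drop l js).
  rewrite pos_cat// pos_affine// sl.
  have /andP[p0 p1] := pos_itv (drop l u) (drop l js) x01.
  by rewrite ltr_norml => /andP[n1 n2]; apply/andP; split; nra.
have : (#|W| <= #|V| * #|J| ^ m)%N.
  rewrite -(card_imset W f_inj) (leq_trans (subset_leq_card sub))//.
  by rewrite cardsX cardsT card_tuple.
rewrite -(ler_nat R) natrM natrX => /le_trans; apply.
by rewrite ler_wpM2r// exprn_ge0.
Qed.

(** Take the least [l] with [r ^+ l <= rho] in [card_pos_near]. Then [rho] and [r ^+ l] agree up to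
    the factor [r], and [#|J| ^- l] is [r ^+ l] raised to the similarity dimension
    [ln #|J| / - ln r]. *)
Lemma card_pos_near_powR (K : nat) (u : seq A) (x0 x rho : R) :
  (0 < #|J|)%N -> size u = K -> 0 <= x0 <= 1 -> 0 < rho <= 1 -> r ^+ K <= rho ->
  #|[set js : K.-tuple J | `|pos u js x0 - x| < rho]%SET|%:R <=
    4 / r * #|J|%:R ^+ K * rho `^ (ln #|J|%:R / - ln r) :> R.
Proof.
move=> J0 su x01 /andP[rho0 rho1] rK.
have ex : exists l, r ^+ l <= rho by exists K.
have [l rl lmin] := ex_minnP ex.
have lK : (l <= K)%N by exact: lmin.
have rlr : rho <= r ^+ l / r.
  case: l rl lmin lK => [|l] rl lmin _.
    by rewrite expr0 (le_trans rho1)// ler_pdivlMr// mul1r ltW.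
  rewrite exprSr mulfK ?gt_eqF// leNgt; apply/negP => /ltW/lmin.
  by rewrite ltnn.
move: su; rewrite -(subnKC lK) => su.
apply: le_trans (card_pos_near x su x01 rho0) _.
have rl0 : 0 < r ^+ l by rewrite exprn_gt0.
have JR : 1 <= #|J|%:R :> R by rewrite ler1n.
have JR0 : 0 < #|J|%:R :> R by apply: lt_le_trans JR.
have lnr : ln r < 0 by rewrite ln_lt0// r0 r1.
have h : #|J|%:R ^- l <= rho `^ (ln #|J|%:R / - ln r) :> R.
  have -> : #|J|%:R ^- l = (r ^+ l) `^ (ln #|J|%:R / - ln r) :> R.
    rewrite -powR_mulrn ?(ltW r0)// -powRrM.
    rewrite -powR_mulrn ?(ltW JR0)// -powRN /powR !gt_eqF//; congr expR.
    by field; rewrite lt_eqF.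
  apply: ge0_ler_powR; rewrite ?nnegrE ?(ltW rl0) ?(ltW rho0)//.
  by rewrite divr_ge0 ?ln_ge0// oppr_ge0 ltW.
rewrite exprD -[leRHS]mulrA -(mulrA (_ ^+ l)).
have JK0 k : 0 < #|J|%:R ^+ k :> R by rewrite exprn_gt0.
have -> : (2 * rho / r ^+ l + 2) * #|J|%:R ^+ (K - l) =
   (2 * rho / r ^+ l + 2) * (#|J|%:R ^+ l * (#|J|%:R ^+ (K - l) * #|J|%:R ^- l)) :> R.
  by field; rewrite !gt_eqF.
apply: ler_pM.
- by rewrite addr_ge0// divr_ge0 ?mulr_ge0 ?ltW.
- by rewrite !mulr_ge0 ?invr_ge0 ?ltW.
- rewrite ler_pdivlMr// mulrDl.
  have : 2 * rho / r ^+ l * r <= 2.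
    by rewrite mulrAC ler_pdivrMr//; move: rlr; rewrite ler_pdivlMr//; lra.
  by move: r1; lra.
- by rewrite !ler_wpM2l ?(ltW (JK0 _)).
Qed.

End digits.

(** This provides one depth at which the cells are smaller than all squares of a finite cover. *)
Lemma exists_exp_le (R : realType) (r : R) (s : seq R) : 0 < r -> r < 1 ->
  (forall x, x \in s -> 0 < x) -> exists K, forall x, x \in s -> r ^+ K <= x.
Proof.
move=> r0 r1; elim: s => [|y s IH] s0; first by exists 0%N.
have [|K HK] := IH; first by move=> x xs; apply: s0; rewrite inE xs orbT.
have y0 : 0 < y by apply: s0; rewrite mem_head.
have [N _ HN] : \forall n \near \oo, r ^+ n <= y.
  have : (fun n => r ^+ n) @ \oo --> (0 : R).
    by apply: cvg_expr; rewrite gtr0_norm.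
  by move=> /cvgr0_norm_le/(_ _ y0); apply: filterS => n /(le_trans (ler_norm _)).
exists (maxn K N) => x; rewrite inE => /orP[/eqP->|xs].
  by apply: HN; rewrite /= leq_maxr.
apply: le_trans (HK _ xs); apply: ler_wiXn2l; rewrite ?ltW//.
exact: leq_maxl.
Qed.

Lemma sumr_indicator_card (R : realType) (T : finType) (P : pred T) :
  \sum_(x : T) (P x)%:R = #|[set x | P x]%SET|%:R :> R.
Proof.
rewrite -natr_sum; congr (_%:R); rewrite -sum1_card [RHS]big_mkcond/=.
by apply: eq_bigr => x _; rewrite inE; case: (P x).
Qed.

(** Double counting replaces a measure. All [#|I| ^ K * #|J| ^ K] images of [z0] under words of
    length [K] lie in [E], hence in squares of [F]. A square of radius [rho] receives at most a
    constant times [rho] to the power [ln #|I| / - ln q2 + ln #|J| / - ln q1] of their number, so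
    the sum of these powers over [F] is bounded below. *)
Lemma hausdorff_measure_uniform_neq0 (R : realType) (I J : finType) (q1 q2 : R)
    (c1 : I -> J -> R) (c2 : I -> R) (E : set (R * R)) (z0 : R * R) (t : R) :
  0 < q1 < 1 -> 0 < q2 < 1 -> (0 < #|I|)%N -> (0 < #|J|)%N ->
  (forall i j, 0 <= c1 i j <= 1 - q1) -> (forall i, 0 <= c2 i <= 1 - q2) ->
  (forall i j j', j != j' -> q1 <= `|c1 i j - c1 i j'|) ->
  (forall i i', i != i' -> q2 <= `|c2 i - c2 i'|) ->
  compact E -> E z0 -> 0 <= z0.1 <= 1 -> 0 <= z0.2 <= 1 ->
  (forall z i j, E z -> E (q1 * z.1 + c1 i j, q2 * z.2 + c2 i)) ->
  0 <= t -> t < ln #|I|%:R / - ln q2 + ln #|J|%:R / - ln q1 ->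
  hausdorff_measure t E <> 0%E.
Proof.
move=> /andP[q10 q11] /andP[q20 q21] I0 J0 c1i c2i c1s c2s cE Ez0 x01 y01 invE t0 ts.
have C10 : 0 < 4 / q1 by rewrite divr_gt0.
have C20 : 0 < 4 / q2 by rewrite divr_gt0.
have c0 : 0 < (4 / q2 * (4 / q1))^-1 by rewrite invr_gt0 mulr_gt0.
apply: (hausdorff_measure_neq0 cE c0 t0 ts) => F F01 EF.
have [|K1 HK1] := @exists_exp_le R q1 [seq x.2 | x <- F] q10 q11.
  by move=> _ /mapP[x /F01/andP[x0 _] ->].
have [|K2 HK2] := @exists_exp_le R q2 [seq x.2 | x <- F] q20 q21.
  by move=> _ /mapP[x /F01/andP[x0 _] ->].
pose K := maxn K1 K2.
pose p1 (w : seq I) (v : seq J) := pos q1 c1 w v z0.1.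
(* Vertical offsets depend on no further letter, hence the context alphabet [unit]; for [p1] the row
   word [w] is the context. *)
pose p2 (w : seq I) := pos q2 (fun _ : unit => c2) (nseq (size w) tt) w z0.2.
have Ep (w : seq I) (v : seq J) : size w = size v -> E (p1 w v, p2 w).
  elim: w v => [|i w IH] [|j v]//; first by rewrite /p1 /p2 /= -surjective_pairing.
  by move=> [/IH/(invE _ i j)].
have near_le (x : (R * R) * R) : x \in F ->
    \sum_(w : K.-tuple I) \sum_(v : K.-tuple J)
      ((`|p2 w - x.1.2| < x.2) && (`|p1 w v - x.1.1| < x.2))%:R <=
    4 / q2 * (4 / q1) * (#|I|%:R ^+ K * #|J|%:R ^+ K) *
      x.2 `^ (ln #|I|%:R / - ln q2 + ln #|J|%:R / - ln q1).
  move=> xF; have x01' := F01 _ xF; have /andP[xpos _] := x01'.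
  set B1 := 4 / q1 * #|J|%:R ^+ K * x.2 `^ (ln #|J|%:R / - ln q1).
  have B10 : 0 <= B1 by rewrite !mulr_ge0 ?powR_ge0 ?exprn_ge0 ?invr_ge0 ?ler0n ?(ltW q10).
  pose S1 : R := \sum_(w : K.-tuple I) (`|p2 w - x.1.2| < x.2 :> R)%:R * B1.
  (* For each row word that passes the vertical test, the words [v] inside the row are counted
     first; the row words are counted afterwards. *)
  apply: (@le_trans _ _ S1).
    apply: ler_sum => w _; case: (_ < _); last by rewrite mul0r big1.
    rewrite mul1r sumr_indicator_card; apply: card_pos_near_powR => //.
      by rewrite size_tuple.
    apply: le_trans (HK1 _ (map_f _ xF)); apply: ler_wiXn2l; rewrite ?ltW//.
    exact: leq_maxl.
  rewrite /S1 -mulr_suml sumr_indicator_card.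
  set B2 := 4 / q2 * #|I|%:R ^+ K * x.2 `^ (ln #|I|%:R / - ln q2).
  apply: (@le_trans _ _ (B2 * B1)).
    rewrite ler_wpM2r//.
    rewrite (_ : [set w : K.-tuple I | _]%SET =
       [set w : K.-tuple I | `|pos q2 (fun _ : unit => c2) (nseq K tt) w z0.2 - x.1.2| < x.2]%SET).
      apply: card_pos_near_powR => //.
        by rewrite size_nseq.
      apply: le_trans (HK2 _ (map_f _ xF)); apply: ler_wiXn2l; rewrite ?ltW//.
      exact: leq_maxr.
    by apply/setP => w; rewrite !inE /p2 size_tuple.
  rewrite powRD ?(gt_eqF xpos) ?implybT// /B1 /B2.
  by rewrite le_eqVlt; apply/orP; left; apply/eqP; ring.
(* Each pair [(w, v)] is counted at least once, since its image point lies in some square of [F]. *)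
have total : #|I|%:R ^+ K * #|J|%:R ^+ K <= \sum_(x <- F)
    \sum_(w : K.-tuple I) \sum_(v : K.-tuple J)
      ((`|p2 w - x.1.2| < x.2) && (`|p1 w v - x.1.1| < x.2))%:R :> R.
  rewrite exchange_big/=.
  under eq_bigr do rewrite exchange_big/=.
  have -> : #|I|%:R ^+ K * #|J|%:R ^+ K =
     \sum_(w : K.-tuple I) \sum_(v : K.-tuple J) 1 :> R.
    rewrite sumr_const sumr_const !card_tuple -mulrnA -natrX -natrX -natrM.
    by rewrite mulnC.
  apply: ler_sum => w _; apply: ler_sum => v _.
  have [x xF [/= n1 n2]] := EF _ (Ep w v (etrans (size_tuple w) (esym (size_tuple v)))).
  rewrite (big_rem x xF)/= n1 n2/= lerDl; apply: sumr_ge0 => y _.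
  by rewrite ler0n.
have IJ0 : 0 < #|I|%:R ^+ K * #|J|%:R ^+ K :> R.
  by rewrite mulr_gt0// exprn_gt0// ltr0n.
have : #|I|%:R ^+ K * #|J|%:R ^+ K <= 4 / q2 * (4 / q1) *
    (#|I|%:R ^+ K * #|J|%:R ^+ K) * \sum_(x <- F)
      x.2 `^ (ln #|I|%:R / - ln q2 + ln #|J|%:R / - ln q1).
  apply: (le_trans total); rewrite mulr_sumr big_seq [leRHS]big_seq.
  by apply: ler_sum => x xF; exact: near_le.
set S := \sum_(x <- F) _; rewrite mulrAC -[leLHS]mul1r ler_pM2r// => h.
by rewrite -[leLHS]mul1r ler_pdivrMr ?(mulr_gt0 C20 C10)// mulrC.
Qed.

(** * Words, levels and separation *)

Section words.
Variables (K : choiceType) (op : K -> K -> K) (e : K).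
Hypotheses (opA : associative op) (op0 : left_id e op) (op1 : right_id e op).

Lemma wordsS_P (F : {fset K}) (n : nat) (x : K) :
  reflect (exists S W, [/\ S \in F, W \in words op e F n & x = op S W])
    (x \in words op e F n.+1).
Proof.
apply: (iffP (imfset2P _ _ _ _ _)) => [[S SF [W Wn ->]]|[S [W [SF Wn ->]]]].
  by exists S, W.
by exists S => //; exists W.
Qed.

Lemma words1 (F : {fset K}) : words op e F 1 = F.
Proof.
apply/fsetP => x; apply/wordsS_P/idP => [[S [W [SF]]]|xF].
  by rewrite inE => /eqP-> ->; rewrite op1.
by exists x, e; rewrite inE eqxx op1.
Qed.

Lemma words_addP (F : {fset K}) (n m : nat) (x : K) :
  reflect (exists S W, [/\ S \in words op e F n, W \in words op e F m & x = op S W])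
    (x \in words op e F (n + m)).
Proof.
apply: (iffP idP); elim: n x => [|n IH] x.
- by move=> xm; exists e, x; rewrite inE eqxx op0.
- rewrite addSn => /wordsS_P[S [W [SF /IH[S' [W' [S'n W'm ->]]] ->]]].
  exists (op S S'), W'; split => //.
  by apply/wordsS_P; exists S, S'.
- by move=> [S [W []]]; rewrite inE => /eqP-> Wm ->; rewrite op0.
- move=> [S [W [/wordsS_P[S1 [S2 [S1F S2n ->]]] Wm ->]]].
  rewrite addSn; apply/wordsS_P; exists S1, (op S2 W); split => //.
  by apply: IH; exists S2, W.
Qed.

Lemma card_words (F : {fset K}) (n : nat) :
  (#|` words op e F n| <= #|` F| ^ n)%N.
Proof.
elim: n => [|n IH]; first by rewrite cardfs1.
apply: (@leq_trans (size [seq op x y | x <- F, y <- words op e F n])).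

  apply: uniq_leq_size; first exact: fset_uniq.
  by move=> _ /wordsS_P[S [W [SF Wn ->]]]; apply: allpairs_f.
by rewrite size_allpairs expnS leq_mul2l IH orbT.
Qed.

End words.

(** * Composition of affine maps and consequences of the normalization *)

Section affine_maps.
Variable R : realType.

Lemma acompA : associative (@acomp R).
Proof. by move=> f g h; rewrite /acomp/ratio/transl/=; congr pair; ring. Qed.

Lemma acomp1f : left_id (aid R) (@acomp R).
Proof. by move=> [a b]; rewrite /acomp/ratio/transl/=; congr pair; ring. Qed.

Lemma acompf1 : right_id (aid R) (@acomp R).
Proof. by move=> [a b]; rewrite /acomp/ratio/transl/=; congr pair; ring. Qed.

Lemma ccompA : associative (@ccomp R).
Proof. by move=> f g h; rewrite /ccomp/= !acompA. Qed.

Lemma ccomp1f : left_id (cid R) (@ccomp R).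
Proof. by move=> [a b]; rewrite /ccomp/= !acomp1f. Qed.

Lemma ccompf1 : right_id (cid R) (@ccomp R).
Proof. by move=> [a b]; rewrite /ccomp/= !acompf1. Qed.

Lemma level_addP (G : {fset cmap R}) (n m : nat) (S : cmap R) :
  reflect (exists S1 S2, [/\ S1 \in level G n, S2 \in level G m & S = ccomp S1 S2])
    (S \in level G (n + m)).
Proof. exact: (words_addP ccompA ccomp1f). Qed.

Lemma proj_ifs2P (F : {fset cmap R}) (T : amap R) :
  reflect (exists2 S, S \in F & T = S.2) (T \in proj_ifs2 F).
Proof. exact: imfsetP. Qed.

Lemma proj_level_words (G : {fset cmap R}) (n : nat) (T : amap R) :
  T \in proj_ifs2 (level G n) -> T \in words (@acomp R) (aid R) (proj_ifs2 G) n.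
Proof.
move=> /proj_ifs2P[S + ->]; elim: n S => [|n IH] S.
  by rewrite !inE => /eqP->.
move=> /wordsS_P[A [W [AG Wn ->]]]; apply/wordsS_P; exists A.2, W.2.
by split => //; [apply/proj_ifs2P; exists A|exact: IH].
Qed.

Lemma convex_set_affine_preim (r t a b : R) :
  @convex_set R R^o [set u | a <= r * u + t <= b].
Proof.
move=> x y l; rewrite !inE /= => /andP[x1 x2] /andP[y1 y2].
have -> : conv l x y = l%:num * (x : R) + (1 - l%:num) * (y : R) by [].
have l0 : 0 <= l%:num by [].
have l1 : l%:num <= 1 by [].
move: l0 l1; set k := l%:num => l0 l1; rewrite /=.
by apply/andP; split; nra.
Qed.

(** The preimage of [[0, 1]] under the map is convex and contains [A], hence contains the hull of
    [A]; the bounds are read off at 0 and 1. *)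
Lemma affine_bounds (A : set R) (r t : R) : convex_hull A = `[0, 1]%classic ->
  (forall u, A u -> A (r * u + t)) -> 0 <= t /\ r + t <= 1.
Proof.
move=> hA invA.
have sub : `[0, 1]%classic `<=` [set u | 0 <= r * u + t <= 1].
  rewrite -hA; apply: smallest_sub; first exact: convex_set_affine_preim.
  move=> u /invA Au; suff : `[0, 1]%classic (r * u + t) by rewrite /= in_itv.
  by rewrite -hA; exact: sub_gen_smallest.
have /sub/= : (`[0, 1]%classic : set R) 0 by rewrite /= in_itv/= lexx ler01.
have /sub/= : (`[0, 1]%classic : set R) 1 by rewrite /= in_itv/= lexx ler01.
by move=> /andP[_ h1] /andP[h0 _]; split; lra.
Qed.

Lemma setX_itv01 (A B : set R) :
  A `*` B = `[0, 1]%classic `*` `[0, 1]%classic ->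
  A = `[0, 1]%classic /\ B = `[0, 1]%classic.
Proof.
move=> AB.
have [A0 B0] : (A `*` B) (0, 0) by rewrite AB; split; rewrite /= in_itv/= lexx ler01.
split; apply/seteqP; split => x xA.
- by have [] : (`[0, 1]%classic `*` `[0, 1]%classic) (x, 0 : R) by rewrite -AB.
- have [] // : (A `*` B) (x, 0).
  by rewrite AB; split => //=; rewrite in_itv/= lexx ler01.
- by have [] : (`[0, 1]%classic `*` `[0, 1]%classic) (0 : R, x) by rewrite -AB.
- have [] // : (A `*` B) (0, x).
  by rewrite AB; split => //=; rewrite in_itv/= lexx ler01.
Qed.

End affine_maps.

(** * Geometry of the carpet: bounds, prefixes and separation at each level *)

Section carpet.
Variables (R : realType) (G : {fset cmap R}) (L : set (R * R)) (r1 r2 : R).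
Hypotheses (L_attractor : is_attractor G L) (L_normalized : normalized L)
  (G_homogeneous : homogeneous G r1 r2) (G_rosc : rectangular_osc G)
  (G_wsc : weak_separation (proj_ifs2 G)).

Let r1_gt0 : 0 < r1. Proof. by case: G_homogeneous. Qed.
Let r2_gt0 : 0 < r2. Proof. by case: G_homogeneous. Qed.

Lemma attractor_map (S : cmap R) (z : R * R) : S \in G -> L z -> L (ceval S z).
Proof.
case: L_attractor => _ _ LE SG Lz; rewrite LE.
by exists S => //; exists z.
Qed.

Lemma attractor_sub01 (z : R * R) : L z -> 0 <= z.1 <= 1 /\ 0 <= z.2 <= 1.
Proof.
have [h1 h2] := setX_itv01 L_normalized => Lz.
have : (`[0, 1]%classic : set R) z.1 by rewrite -h1; apply: sub_gen_smallest; exists z.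
have : (`[0, 1]%classic : set R) z.2 by rewrite -h2; apply: sub_gen_smallest; exists z.
by rewrite /= !in_itv.
Qed.

Lemma generator_bounds (S : cmap R) : S \in G ->
  [/\ ratio S.1 = r1, ratio S.2 = r2,
      0 <= transl S.1 <= 1 - r1 & 0 <= transl S.2 <= 1 - r2].
Proof.
move=> SG; have [h1 h2] := setX_itv01 L_normalized.
have [_ _ /(_ _ SG)[e1 e2]] := G_homogeneous.
have [|a1 b1] := @affine_bounds R _ r1 (transl S.1) h1.
  move=> _ [z Lz <-]; exists (ceval S z); first exact: attractor_map.
  by rewrite /ceval/aeval/= e1.
have [|a2 b2] := @affine_bounds R _ r2 (transl S.2) h2.
  move=> _ [z Lz <-]; exists (ceval S z); first exact: attractor_map.
  by rewrite /ceval/aeval/= e2.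
by split => //; apply/andP; split => //; lra.
Qed.

Lemma level_bounds (n : nat) (S : cmap R) : S \in level G n ->
  [/\ ratio S.1 = r1 ^+ n, ratio S.2 = r2 ^+ n,
      0 <= transl S.1 <= 1 - r1 ^+ n & 0 <= transl S.2 <= 1 - r2 ^+ n].
Proof.
elim: n S => [|n IH] S.
  rewrite inE => /eqP->; rewrite !expr0 /cid /aid /ratio /transl/=.
  by split => //; rewrite subrr lexx.
move=> /wordsS_P[A [W [/generator_bounds[a1 a2 /andP[a3 a4] /andP[a5 a6]]]]].
move=> /IH[w1 w2 /andP[w3 w4] /andP[w5 w6]] ->; rewrite /ccomp/acomp/=.
split; rewrite /ratio/= -?/(ratio _) ?a1 ?a2 ?w1 ?w2 ?exprS//;
  rewrite /transl/= -?/(transl _); apply/andP; split.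
- by rewrite addr_ge0// mulr_ge0// ltW.
- have : r1 * transl W.1 <= r1 * (1 - r1 ^+ n) by rewrite ler_pM2l.
  by lra.
- by rewrite addr_ge0// mulr_ge0// ltW.
- have : r2 * transl W.2 <= r2 * (1 - r2 ^+ n) by rewrite ler_pM2l.
  by lra.
Qed.

Lemma proj_level_bounds (n : nat) (T : amap R) : T \in proj_ifs2 (level G n) ->
  ratio T = r2 ^+ n /\ 0 <= transl T <= 1 - r2 ^+ n.
Proof. by move=> /proj_ifs2P[S /level_bounds[_ ? _ ?] ->]. Qed.

Lemma level_attractor (n : nat) (S : cmap R) (z : R * R) :
  S \in level G n -> L z -> L (ceval S z).
Proof.
elim: n S => [|n IH] S.
  by rewrite inE => /eqP->; rewrite ceval_id.
move=> /wordsS_P[A [W [AG Wn ->]]] Lz; rewrite ceval_comp/=.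
by apply: attractor_map => //; exact: IH.
Qed.

(** Self-similarity of [L] is applied again and again: [zs n] is the point left after removing [n]
    generators, and [P n] composes the removed ones. *)
Lemma attractor_prefixes (z : R * R) : L z ->
  exists P : nat -> cmap R,
    [/\ forall n, P n \in level G n,
        forall n m, exists2 Q, Q \in level G m & P (n + m)%N = ccomp (P n) Q &
        forall n, exists2 z', L z' & z = ceval (P n) z'].
Proof.
move=> Lz.
(* The choice of a generator is made total by a dummy value outside [L]. *)
have step (y : R * R) : exists p : cmap R * (R * R),
    L y -> [/\ p.1 \in G, L p.2 & y = ceval p.1 p.2].
  have [Ly|nLy] := pselect (L y); last by exists (cid R, y).
  have [_ _ LE] := L_attractor.
  by move: Ly; rewrite {1}LE => -[S SG [y' Ly' <-]]; exists (S, y').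
have [f fP] := choice step.
pose zs n := iter n (fun y => (f y).2) z.
have Lzs n : L (zs n) by elim: n => [|n IH]//=; have [] := fP _ IH.
pose P := fix P n := if n is m.+1 then ccomp (P m) (f (zs m)).1 else cid R.
have fG n : (f (zs n)).1 \in level G 1.
  by rewrite /level (words1 (@ccompf1 R)); have [] := fP _ (Lzs n).
have PS n m : exists2 Q, Q \in level G m & P (n + m)%N = ccomp (P n) Q.
  elim: m => [|m [Q Qm PQ]].
    by exists (cid R); rewrite ?addn0 ?ccompf1// inE.
  exists (ccomp Q (f (zs (n + m)%N)).1).
    by rewrite -addn1; apply/level_addP; exists Q, (f (zs (n + m)%N)).1.
  by rewrite addnS /= PQ ccompA.
exists P; split => //.
- by move=> n; have [Q Qn] := PS 0%N n; rewrite add0n ccomp1f => ->.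
- move=> n; exists (zs n) => //; elim: n => [|n IH].
    by rewrite /= ceval_id.
  rewrite [P _]/= ceval_comp /= {1}IH; congr ceval.
  by have [] := fP _ (Lzs n).
Qed.

(** Maps of a level send the open unit square into itself, so a common image point lies in the open
    rectangles of both outermost generators. The open set condition identifies these; they are then
    cancelled. *)
Lemma level_inj (n : nat) (S S' : cmap R) (p q : R * R) :
  S \in level G n -> S' \in level G n ->
  0 < p.1 < 1 -> 0 < p.2 < 1 -> 0 < q.1 < 1 -> 0 < q.2 < 1 ->
  ceval S p = ceval S' q -> S = S'.
Proof.
move=> + + p1 p2 q1 q2; elim: n S S' => [|n IH] S S'.
  by rewrite !inE => /eqP-> /eqP->.
have inU W (y : R * R) : W \in level G n -> 0 < y.1 < 1 -> 0 < y.2 < 1 ->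
    0 < (ceval W y).1 < 1 /\ 0 < (ceval W y).2 < 1.
  move=> /level_bounds[w1 w2 /andP[w3 w4] /andP[w5 w6]] /andP[y1 y2] /andP[y3 y4].
  rewrite /ceval/aeval/= w1 w2.
  have e1 : 0 < r1 ^+ n by rewrite exprn_gt0.
  have e2 : 0 < r2 ^+ n by rewrite exprn_gt0.
  have := mulr_gt0 e1 y1; have := mulr_gt0 e2 y3.
  have : r1 ^+ n * y.1 < r1 ^+ n * 1 by rewrite ltr_pM2l.
  have : r2 ^+ n * y.2 < r2 ^+ n * 1 by rewrite ltr_pM2l.
  by move=> ? ? ? ?; split; apply/andP; split; lra.
move=> /wordsS_P[A [W [AG Wn ->]]] /wordsS_P[A' [W' [A'G W'n ->]]].
rewrite !ceval_comp /= => e.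
have [Wp1 Wp2] := inU _ _ Wn p1 p2; have [Wq1 Wq2] := inU _ _ W'n q1 q2.
have AA' : A = A'.
  apply: contrapT => /(G_rosc AG A'G)/seteqP[sub _].
  apply: (sub (ceval A (ceval W p))); split.
    by exists (ceval W p) => //; split; rewrite /= in_itv.
  by exists (ceval W' q) => //; split; rewrite /= in_itv.
rewrite AA' in e *; congr ccomp; apply: IH => //.
have [a1 a2 _ _] := generator_bounds A'G.
case: e; rewrite /aeval a1 a2 => /addIr e1 /addIr e2.
rewrite [LHS]surjective_pairing [RHS]surjective_pairing; congr pair.
  by apply: (mulfI _ e1); rewrite gt_eqF.
by apply: (mulfI _ e2); rewrite gt_eqF.
Qed.

(** Two maps of one fibre shifted by less than [r1 ^+ n] have overlapping open rectangles, against
    [level_inj]. The points with abscissae [(1 + d) / 2] and [(1 - d) / 2] have a common image. *)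
Lemma level_fibre_sep (n : nat) (S S' : cmap R) :
  S \in level G n -> S' \in level G n -> S.2 = S'.2 -> S != S' ->
  r1 ^+ n <= `|transl S.1 - transl S'.1|.
Proof.
move=> Sn S'n e2 /eqP SS'; rewrite leNgt; apply/negP => lt; apply: SS'.
have e0 : 0 < r1 ^+ n by rewrite exprn_gt0.
pose d := (transl S'.1 - transl S.1) / r1 ^+ n.
have [d1 d2] : -1 < d /\ d < 1.
  apply/andP; rewrite -ltr_norml normrM normfV (gtr0_norm e0) ltr_pdivrMr//.
  by rewrite mul1r distrC.
apply: (@level_inj n _ _ ((1 + d) / 2, 2^-1) ((1 - d) / 2, 2^-1)) => //=;
  try by apply/andP; split; lra.
have [a1 a2 _ _] := level_bounds Sn; have [a1' a2' _ _] := level_bounds S'n.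
rewrite /ceval/aeval/= e2 a1 a1'; congr pair; rewrite /d.
by field; rewrite gt_eqF.
Qed.

Lemma proj_level_sep : exists2 eps, 0 < eps <= 1 & forall n T T',
  T \in proj_ifs2 (level G n) -> T' \in proj_ifs2 (level G n) -> T != T' ->
  eps * r2 ^+ n <= `|transl T - transl T'|.
Proof.
have [_ [V nV VA]] := G_wsc.
have /nbhs_ballP[e /= e0 eV] : nbhs (aid R : (R * R)%type) V by [].
exists (Num.min e 1).
  by rewrite lt_min e0 ltr01 ge_min lexx orbT.
(* Level 0 is treated apart, because [star] contains only words of positive length; it has a single
   map. *)
move=> [|n] T T' Tn T'n TT'.
  move: Tn T'n TT' => /proj_ifs2P[S + ->] /proj_ifs2P[S' + ->].
  by rewrite inE => /eqP->; rewrite inE => /eqP->; rewrite eqxx.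
rewrite leNgt; apply/negP => lt; move/eqP: TT'; apply.
have [a1 _] := proj_level_bounds Tn; have [a1' _] := proj_level_bounds T'n.
have e1 : 0 < r2 ^+ n.+1 by rewrite exprn_gt0.
have : (V `&` [set acomp (ainv f) g | f in star (proj_ifs2 G) &
    g in star (proj_ifs2 G)]) (acomp (ainv T) T').
  split; last first.
    by exists T; [exists n.+1 => //; exact: proj_level_words|
       exists T' => //; exists n.+1 => //; exact: proj_level_words].
  apply: eV; split; rewrite /acomp/ainv/aid/ball/=.
    by rewrite /ratio/= -!/(ratio _) a1 a1' mulVf ?gt_eqF// subrr normr0.
  rewrite /transl/ratio/= -!/(ratio _) -!/(transl _) a1 sub0r normrN.
  rewrite mulrC -mulrBl normrM normfV (gtr0_norm e1) ltr_pdivrMr// distrC.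
  apply: lt_le_trans lt _; by rewrite ler_pM2r// ge_min lexx.
rewrite VA /= /acomp/ainv/aid/transl/ratio/= => -[_].
rewrite -!/(ratio _) -!/(transl _) a1 mulrC -mulrBl => /eqP.
rewrite mulf_eq0 invr_eq0 (gt_eqF e1) orbF subr_eq0 => /eqP tt.
move: a1 a1' tt; case: (T) (T') => [a b] [a' b']; rewrite /ratio/transl/=.
by move=> -> -> ->.
Qed.

End carpet.

(** * Fibres of the vertical projection *)

Section fibres.
Variables (R : realType) (G : {fset cmap R}).

Definition fibre (n : nat) (T : amap R) : {fset cmap R} :=
  [fset S in level G n | S.2 == T].

Definition fibre_card (n : nat) (T : amap R) : R := #|` fibre n T|%:R.

(** At [s = ln r2 / ln r1] this is the sum of the theorem, called Z_n in the overview. *)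
Definition fibre_sum (s : R) (n : nat) : R :=
  \sum_(T <- proj_ifs2 (level G n)) fibre_card n T `^ s.

(** Pairs are kept uncomposed, because different pairs may have the same composition. *)
Definition proj_pairs (n m : nat) : seq (amap R * amap R) :=
  [seq (T1, T2) | T1 <- proj_ifs2 (level G n), T2 <- proj_ifs2 (level G m)].

Lemma mem_fibre (n : nat) (T : amap R) (S : cmap R) :
  (S \in fibre n T) = (S \in level G n) && (S.2 == T).
Proof. by rewrite !inE. Qed.

Lemma fibre_card_ge1 (n : nat) (T : amap R) : T \in proj_ifs2 (level G n) ->
  1 <= fibre_card n T.
Proof.
move=> /proj_ifs2P[S Sn TS]; rewrite /fibre_card ler1n cardfs_gt0.
by apply/fset0Pn; exists S; rewrite mem_fibre Sn TS eqxx.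
Qed.

Lemma fibre_card_le (n : nat) (T : amap R) :
  (#|` fibre n T| <= #|` G| ^ n)%N.
Proof.
apply: leq_trans (card_words (@ccomp R) (cid R) G n); apply: fsubset_leq_card.
by apply/fsubsetP => S; rewrite mem_fibre => /andP[].
Qed.

Lemma fibre_cardE (n : nat) (T : amap R) :
  fibre_card n T = \sum_(S <- level G n | S.2 == T) 1.
Proof.
by rewrite /fibre_card card_fset_sum1 natr_sum big_fset.

Qed.

Lemma sum_level_proj (n : nat) (F : amap R -> R) :
  \sum_(S <- level G n) F S.2 =
  \sum_(T <- proj_ifs2 (level G n)) fibre_card n T * F T.
Proof.
rewrite (partition_big_imfset _ (fun S : cmap R => S.2))/=.
apply: eq_bigr => T _; rewrite fibre_cardE mulr_suml.
by apply: eq_bigr => S /eqP->; rewrite mul1r.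
Qed.

Lemma mem_proj_pairs (n m : nat) (p : amap R * amap R) :
  (p \in proj_pairs n m) =
  (p.1 \in proj_ifs2 (level G n)) && (p.2 \in proj_ifs2 (level G m)).
Proof.
apply/allpairsP/andP => [[q [q1 q2 ->]]//|[p1 p2]].
by exists p; split => //; exact: surjective_pairing.
Qed.

Lemma uniq_proj_pairs (n m : nat) : uniq (proj_pairs n m).
Proof.
by rewrite allpairs_uniq ?fset_uniq// => -[? ?] [? ?] _ _ [-> ->].
Qed.

Lemma proj_pairs_comp (n m : nat) (p : amap R * amap R) :
  p \in proj_pairs n m -> acomp p.1 p.2 \in proj_ifs2 (level G (n + m)).
Proof.
rewrite mem_proj_pairs => /andP[/proj_ifs2P[S Sn ->] /proj_ifs2P[W Wm ->]].
by apply/proj_ifs2P; exists (ccomp S W) => //; apply/level_addP; exists S, W.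
Qed.

Lemma sum_proj_pairs (n m : nat) (F : amap R * amap R -> R) :
  \sum_(p <- proj_pairs n m) F p = \sum_(T <- proj_ifs2 (level G (n + m)))
    \sum_(p <- proj_pairs n m | acomp p.1 p.2 == T) F p.
Proof.
under [RHS]eq_bigr do rewrite big_mkcond.
rewrite exchange_big/= big_seq [RHS]big_seq; apply: eq_bigr => p /proj_pairs_comp pT.
rewrite (bigD1_seq _ pT) ?fset_uniq//= eqxx big1 ?addr0// => T.
by rewrite eq_sym => /negbTE->.
Qed.

(** Splitting a word after [n] letters exhibits every element of the fibre as a composition
    [ccomp S1 S2] whose projections compose to [T]. *)
Lemma fibre_card_add_le (n m : nat) (T : amap R) :
  fibre_card (n + m) T <= \sum_(p <- proj_pairs n m | acomp p.1 p.2 == T)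
    fibre_card n p.1 * fibre_card m p.2.
Proof.
pose s := [seq p <- [seq (S1, S2) | S1 <- level G n, S2 <- level G m] |
  acomp p.1.2 p.2.2 == T].
have : (#|` fibre (n + m) T| <= size [seq ccomp p.1 p.2 | p <- s])%N.
  apply: uniq_leq_size; first exact: fset_uniq.
  move=> S; rewrite mem_fibre => /andP[/level_addP[S1 [S2 [S1n S2m ->]]] ST].
  apply/mapP; exists (S1, S2) => //; rewrite mem_filter ST.
  by apply: allpairs_f.
rewrite size_map -(ler_nat R) => /le_trans; apply.
rewrite le_eqVlt; apply/orP; left; apply/eqP.
rewrite -sum1_size natr_sum big_filter big_mkcond big_allpairs/=.
rewrite (sum_level_proj n (fun T1 => \sum_(j <- level G m) if acomp T1 j.2 == T then 1 else 0)).
rewrite [RHS]big_mkcond big_allpairs/=; apply: eq_bigr => T1 _.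
rewrite (sum_level_proj m (fun T2 => if acomp T1 T2 == T then 1 else 0)) mulr_sumr.
by apply: eq_bigr => T2 _; case: ifP => _; rewrite ?mulr1 ?mulr0.
Qed.

(** Expand the product over pairs and group them by composition; subadditivity of the [s]-th power
    then turns [fibre_card_add_le] into the claim. *)
Lemma fibre_sum_submul (s : R) (n m : nat) : 0 < s -> s <= 1 ->
  fibre_sum s (n + m) <= fibre_sum s n * fibre_sum s m.
Proof.
move=> s0 s1.
have -> : fibre_sum s n * fibre_sum s m =
    \sum_(p <- proj_pairs n m) (fibre_card n p.1 * fibre_card m p.2) `^ s.
  rewrite big_allpairs mulr_suml; apply: eq_bigr => T1 _; rewrite mulr_sumr.
  by apply: eq_bigr => T2 _; rewrite powRM ?ler0n.
rewrite sum_proj_pairs; apply: ler_sum => T _.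
apply: le_trans (powR_sum_le _ s0 s1 _); last by move=> p _; rewrite mulr_ge0 ?ler0n.
apply: ge0_ler_powR; rewrite ?nnegrE ?ler0n ?(ltW s0)//.
  by apply: sumr_ge0 => p _; rewrite mulr_ge0 ?ler0n.
exact: fibre_card_add_le.
Qed.

Lemma fibre_sum_ge1 (s : R) (n : nat) : 0 <= s -> level G n != fset0 ->
  1 <= fibre_sum s n.
Proof.
move=> s0 /fset0Pn[S Sn].
have ST : S.2 \in proj_ifs2 (level G n) by apply/proj_ifs2P; exists S.
rewrite /fibre_sum (big_rem _ ST)/= ler_wpDr//.
  by apply: sumr_ge0 => T _; exact: powR_ge0.
by rewrite -(powRr0 (fibre_card n S.2)) ler_powR ?fibre_card_ge1.
Qed.

(** Divide [k] by [m]: the full blocks contribute the exponential, and the remainder, shorter than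
    [m], contributes at most [fibre_sum s 1 ^+ m]. *)
Lemma fibre_sum_growth (s : R) (m k : nat) : 0 < s -> s <= 1 -> (0 < m)%N ->
  (forall n, level G n != fset0) ->
  fibre_sum s k <=
    fibre_sum s 1 ^+ m * expR (k%:R / m%:R * ln (fibre_sum s m)).
Proof.
move=> s0 s1 m0 G0.
have Z1 n : 1 <= fibre_sum s n by apply: fibre_sum_ge1; rewrite ?ltW.
have Z0 n : 0 < fibre_sum s n by apply: lt_le_trans (Z1 n).
have Zpow n l : fibre_sum s (n * l) <= fibre_sum s n ^+ l.
  elim: l => [|l IH].
    rewrite muln0 expr0 /fibre_sum /proj_ifs2 /level/=
      (_ : [fset _ | _ in _]%fset = [fset aid R]%fset).
      rewrite big_seq_fset1 (_ : fibre_card _ _ = 1) ?powR1// /fibre_card.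
      rewrite (_ : fibre _ _ = [fset cid R]%fset) ?cardfs1//.
      by apply/fsetP => S; rewrite mem_fibre !inE andb_idr// => /eqP->.
    exact: imfset_fset1.
  rewrite mulnS exprS; apply: le_trans (fibre_sum_submul _ _ s0 s1) _.
  by rewrite ler_pM2l.
rewrite {1}(divn_eq k m) addnC.
apply: le_trans (fibre_sum_submul _ _ s0 s1) _.
apply: ler_pM; rewrite ?(ltW (Z0 _))//.
  rewrite -[(k %% m)%N]mul1n; apply: le_trans (Zpow _ _) _.
  by rewrite ler_weXn2l// ltnW// ltn_pmod.
rewrite mulnC; apply: le_trans (Zpow _ _) _.
rewrite -{1}(lnK (x := fibre_sum s m)) ?posrE// -expRM_natl ler_expR.
rewrite ler_wpM2r ?ln_ge0// ler_pdivlMr ?ltr0n// -natrM ler_nat.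
exact: leq_trunc_div.
Qed.

End fibres.

(** * Upper bound *)

(* At every bad scale b j / k j, which lies in [0, B], drops by at least d. *)
Lemma exists_good_scale (R : realType) (s d B : R) (k : nat -> nat)
    (b : nat -> R) (J : nat) :
  0 < s -> s <= 1 -> 0 < d -> (forall j, (0 < k j)%N) ->
  (forall j, (k j)%:R <= s * (k j.+1)%:R) ->
  (forall j, 0 <= b j <= B * (k j)%:R) -> B < J%:R * d ->
  exists2 j, (j < J)%N & - (d * (k j.+1)%:R) <= s * b j.+1 - b j.
Proof.
move=> s0 s1 d0 k0 ks bB JB; apply: contrapT => nex.
have k0R j : 0 < (k j)%:R :> R by rewrite ltr0n.
(* A bad scale satisfies [s * b j.+1 + d * k j.+1 < b j]; dividing by [k j <= s * k j.+1] gives the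
   drop. *)
have step j : (j < J)%N -> b j.+1 / (k j.+1)%:R + d <= b j / (k j)%:R.
  move=> jJ; have lt : s * b j.+1 - b j < - (d * (k j.+1)%:R).
    by rewrite ltNge; apply/negP => le; apply: nex; exists j.
  rewrite ler_pdivlMr//; have /andP[b0 _] := bB j.+1.
  have q0 : 0 <= b j.+1 / (k j.+1)%:R by rewrite divr_ge0// ltW.
  apply: (@le_trans _ _ ((b j.+1 / (k j.+1)%:R + d) * (s * (k j.+1)%:R))).
    by rewrite ler_pM2l// ltr_wpDl.
  have -> : (b j.+1 / (k j.+1)%:R + d) * (s * (k j.+1)%:R) =
      s * b j.+1 + s * (d * (k j.+1)%:R) by field; rewrite gt_eqF.
  have : s * (d * (k j.+1)%:R) <= d * (k j.+1)%:R by rewrite ger_pMl// mulr_gt0.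
  by move: lt; lra.
have tel j : (j <= J)%N -> b j / (k j)%:R + j%:R * d <= b 0%N / (k 0%N)%:R.
  elim: j => [|j IH] jJ; first by rewrite mul0r addr0.
  apply: le_trans (IH (ltnW jJ)); rewrite -natr1 mulrDl mul1r.
  by have := step j jJ; lra.
have := tel J (leqnn _); have /andP[bJ0 _] := bB J; have /andP[_ b0B] := bB 0%N.
have : b 0%N / (k 0%N)%:R <= B by rewrite ler_pdivrMr.
have : 0 <= b J / (k J)%:R by rewrite divr_ge0// ltW.
by move: JB; lra.
Qed.

Section upper_bound.
Variables (R : realType) (G : {fset cmap R}) (L : set (R * R)) (r1 r2 : R).
Hypotheses (L_attractor : is_attractor G L) (L_normalized : normalized L)
  (G_homogeneous : homogeneous G r1 r2) (r1_lt_r2 : r1 < r2)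
  (r2_lt1 : r2 < 1) (G_wsc : weak_separation (proj_ifs2 G)).

Let r1_gt0 : 0 < r1. Proof. by case: G_homogeneous. Qed.
Let r2_gt0 : 0 < r2. Proof. by case: G_homogeneous. Qed.
Let r1_lt1 : r1 < 1. Proof. exact: lt_trans r2_lt1. Qed.
Let theta := ln r2 / ln r1.
Let lnr2 : ln r2 < 0. Proof. by rewrite ln_lt0// r2_gt0. Qed.
Let lnr1 : ln r1 < 0. Proof. by rewrite ln_lt0// r1_gt0. Qed.

Lemma log_ratio_gt0 : 0 < theta.
Proof. by rewrite /theta -[_ / _]divrNN divr_gt0// oppr_gt0. Qed.

Lemma log_ratio_lt1 : theta < 1.
Proof.
by rewrite /theta -[_ / _]divrNN ltr_pdivrMr ?oppr_gt0// mul1r ltrN2 ltr_ln.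
Qed.

Lemma level_neq0 (n : nat) : level G n != fset0.
Proof.
have [[z Lz] _ _] := L_attractor.
have [P [Pn _ _]] := attractor_prefixes L_attractor Lz.
by apply/fset0Pn; exists (P n).
Qed.

(** Given [T], the first factor determines the second by cancellation, and its translation lies
    within [r2 ^+ n] of that of [T]. First factors are separated by a fixed multiple of [r2 ^+ n],
    so boundedly many occur. *)
Lemma proj_pairs_multiplicity : exists2 C : R, 0 < C & forall n m T,
  (size [seq p <- proj_pairs G n m | acomp p.1 p.2 == T])%:R <= C.
Proof.
have [e /andP[e0 _] sep] := proj_level_sep L_attractor L_normalized
  G_homogeneous G_wsc.
exists (e^-1 + 1); first by rewrite addr_gt0// invr_gt0.
move=> n m T; have q0 : 0 < r2 ^+ n by rewrite exprn_gt0.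
have -> : e^-1 + 1 = (transl T - (transl T - r2 ^+ n)) / (e * r2 ^+ n) + 1.
  by field; rewrite !gt_eqF.
apply: (@size_separated R _ _ (fun p => transl p.1)).
- by rewrite mulr_gt0.
- by rewrite lerBlDr lerDl ltW.
- by rewrite filter_uniq// uniq_proj_pairs.
- move=> p; rewrite mem_filter mem_proj_pairs => /andP[/eqP<- /andP[p1 p2]].
  have [a1 _] := proj_level_bounds L_attractor L_normalized G_homogeneous p1.
  have [_ /andP[t0 t1]] := proj_level_bounds L_attractor L_normalized G_homogeneous p2.
  rewrite /acomp /transl/= -!/(transl _) a1.
  have := mulr_ge0 (ltW q0) t0.
  have : r2 ^+ n * transl p.2 <= r2 ^+ n * 1.
    by rewrite ler_pM2l// (le_trans t1)// gerBl exprn_ge0// ltW.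
  by move=> ? ?; apply/andP; split; lra.
- move=> p q; rewrite !mem_filter !mem_proj_pairs.
  move=> /andP[/eqP pT /andP[p1 p2]] /andP[/eqP qT /andP[q1 q2]] pq.
  apply: sep => //; apply: contra_neq pq => e1.
  rewrite [p]surjective_pairing [q]surjective_pairing e1; congr pair.
  have [a1 _] := proj_level_bounds L_attractor L_normalized G_homogeneous q1.
  move: qT; rewrite -pT e1 /acomp a1 => -[+ /addIr].
  move=> /mulfI h1 /mulfI h2; rewrite [p.2]surjective_pairing [q.2]surjective_pairing.
  by congr pair; apply/esym; [apply: h1|apply: h2]; rewrite gt_eqF.
Qed.

Lemma sum_proj_comp_le : exists2 C : R, 0 < C & forall n m (F : amap R -> R),
  (forall T, 0 <= F T) ->
  \sum_(p <- proj_pairs G n m) F (acomp p.1 p.2) <=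
    C * \sum_(T <- proj_ifs2 (level G (n + m))) F T.
Proof.
have [C C0 mult] := proj_pairs_multiplicity; exists C => // n m F F0.
rewrite sum_proj_pairs mulr_sumr; apply: ler_sum => T _.
apply: (@le_trans _ _ ((size [seq p <- proj_pairs G n m | acomp p.1 p.2 == T])%:R * F T)).
  rewrite -sum1_size natr_sum big_filter mulr_suml.
  by apply: ler_sum => p /eqP->; rewrite mul1r.
by rewrite ler_wpM2r.
Qed.

(** Since [r1 ^+ k] is [r2] to the power [k / theta], rounding [k / theta] up makes [r1 ^+ k] and
    [r2 ^+ k'] comparable. *)
Lemma next_scale (k : nat) : exists k' : nat,
  k%:R <= theta * k'%:R /\ k'%:R <= k%:R / theta + 1.
Proof.
have th0 := log_ratio_gt0.
have q0 : 0 <= k%:R / theta by rewrite divr_ge0// ltW.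
exists (Num.truncn (k%:R / theta)).+1; have /andP[h1 h2] := truncn_itv q0.
split; first by rewrite mulrC -ler_pdivrMr// ltW.
by rewrite -natr1 lerD2r.
Qed.

(* The pair (S', T) stands for the rectangle of width r1^l and height r2^k cut
   out by the abscissae of S' and the ordinates of p_2 S' o T. *)
Definition good_pairs (d : R) (l k : nat) : seq (cmap R * amap R) :=
  [seq q <- [seq (S', T) | S' <- level G l, T <- proj_ifs2 (level G (k - l))] |
    expR (- (d * k%:R)) <=
      fibre_card G k (acomp q.1.2 q.2) `^ theta / fibre_card G l q.1.2].

(** This is Markov's inequality for the weights in [good_pairs]. Summing a weight over all [S'] in
    one fibre cancels the denominator, and [sum_proj_comp_le] bounds what remains. *)
Lemma size_good_pairs : exists2 C : R, 0 < C & forall d l k, (l <= k)%N ->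
  (size (good_pairs d l k))%:R <= C * expR (d * k%:R) * fibre_sum G theta k.
Proof.
have [C C0 HC] := sum_proj_comp_le; exists C => // d l k lk.
have := HC l (k - l)%N (fun T => fibre_card G k T `^ theta).
rewrite subnKC// => /(_ (fun T => powR_ge0 _ _)) le.
rewrite mulrAC -ler_pdivrMr ?expR_gt0//; apply: le_trans le.
rewrite -expRN -sum1_size natr_sum mulr_suml big_filter big_mkcond/=.
pose F (q : cmap R * amap R) :=
  fibre_card G k (acomp q.1.2 q.2) `^ theta / fibre_card G l q.1.2.
apply: (@le_trans _ _ (\sum_(q <- [seq (S', T) | S' <- level G l,
    T <- proj_ifs2 (level G (k - l))]) F q)).
  apply: ler_sum => q _; case: ifP => [|_]; first by rewrite mul1r.
  by rewrite divr_ge0 ?powR_ge0// ler0n.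
rewrite big_allpairs/=.
rewrite (sum_level_proj G l (fun T1 => \sum_(T <- proj_ifs2 (level G (k - l)))
  fibre_card G k (acomp T1 T) `^ theta / fibre_card G l T1)).
rewrite big_allpairs/= big_seq [leRHS]big_seq; apply: ler_sum => T1 /fibre_card_ge1 N1.
rewrite -mulr_suml mulrCA divff ?mulr1// gt_eqF//.
exact: lt_le_trans N1.
Qed.

(** The cover consists of the good rectangles at [J] successive scales, where [exists_good_scale]
    ensures that every point of [L] lies in one. Number times size to the power [t] decays
    exponentially in the scale, so a large initial scale suffices. *)
Lemma hausdorff_measure_upper (m : nat) (t : R) : (0 < m)%N ->
  ln (fibre_sum G theta m) / - (m%:R * ln r2) < t -> hausdorff_measure t L = 0%E.
Proof.
move=> m0 at_; set a := _ / _ in at_; set Z := fibre_sum G theta in a at_.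
have th0 := log_ratio_gt0; have th1 := ltW log_ratio_lt1.
have Z1 n : 1 <= Z n by apply: fibre_sum_ge1; [exact: ltW|exact: level_neq0].
have mR0 : 0 < m%:R :> R by rewrite ltr0n.
have a0 : 0 <= a.
  by rewrite divr_ge0 ?ln_ge0// oppr_ge0 pmulr_rle0// ltW.
have t0 : 0 < t by apply: le_lt_trans at_.
(* Half of the available gap: the loss [d] in the definition of good pairs leaves a decay rate of
   [d]. *)
pose d := - ln r2 * (t - a) / 2.
have d0 : 0 < d by rewrite divr_gt0// mulr_gt0 ?oppr_gt0 ?subr_gt0.
have [J BJ] : exists J : nat, ln #|` G|%:R < J%:R * d.
  exists (Num.truncn (ln #|` G|%:R / d)).+1.
  by rewrite -ltr_pdivrMr//; exact: truncnS_gt.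
have [C C0 HC] := size_good_pairs.
pose M := Z 1%N ^+ m.
have M0 : 0 < M by rewrite exprn_gt0// (lt_le_trans _ (Z1 _)).
pose D := C * M * (2 / r2) `^ t.
have D0 : 0 < D by rewrite !mulr_gt0// powR_gt0// divr_gt0.
apply: hausdorff_measure_eq0 => // del e del0 e0.
have JD0 : 0 < J.+1%:R * D by rewrite mulr_gt0.
have [||K1 HK1] := @exists_exp_le R (expR (- d)) [:: e / (J.+1%:R * D)] (expR_gt0 _).
- by rewrite expR_lt1 oppr_lt0.
- by move=> x; rewrite inE => /eqP->; rewrite divr_gt0.
have [|K2 HK2] := @exists_exp_le R r2 [:: del * r2 / 2] r2_gt0 r2_lt1.
  by move=> x; rewrite inE => /eqP->; rewrite !mulr_gt0// invr_gt0.
have {}HK1 := HK1 _ (mem_head _ _); have {}HK2 := HK2 _ (mem_head _ _).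
pose K0 := (maxn K1 K2).+1.
have [nx nxP] := choice next_scale.
have [k [kS0 ks ks']] : exists k : nat -> nat, [/\ k 0%N = K0,
    forall j, (k j)%:R <= theta * (k j.+1)%:R &
    forall j, (k j.+1)%:R <= (k j)%:R / theta + 1].
  by exists (fun j => iter j nx K0); split => // j; have [] := nxP (iter j nx K0).
have kS j : (k j <= k j.+1)%N.
  by rewrite -(ler_nat R) (le_trans (ks j)) ?ler_piMl ?ler0n.
have kK0 j : (K0 <= k j)%N.
  by elim: j => [|j /leq_trans]; [rewrite kS0|apply].
have k0 j : (0 < k j)%N by apply: leq_trans (kK0 j).
(* In both coordinates a rectangle extends over at most [r2 ^+ k j.+1 / r2]; the factor 2 comes from
   [eucl_dist_le_sup]. *)
pose h0 j := 2 / r2 * r2 ^+ k j.+1.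
have h0_ge0 j : 0 <= h0 j by rewrite mulr_ge0 ?exprn_ge0 ?divr_ge0 ?ltW.
have r1k j : r1 ^+ k j <= r2 ^+ k j.+1 / r2.
  rewrite ler_pdivlMr// -(@lnK _ (r1 ^+ k j)) ?posrE ?exprn_gt0//.
  rewrite -[X in _ * X <= _](@lnK _ r2) ?posrE// -expRD.
  rewrite -(@lnK _ (r2 ^+ k j.+1)) ?posrE ?exprn_gt0// ler_expR !lnXn//.
  rewrite -!(mulr_natr (ln _)).
  have -> : ln r1 * (k j)%:R + ln r2 = ln r2 * ((k j)%:R / theta + 1).
    by rewrite /theta; field; rewrite !lt_eqF.
  by rewrite ler_nM2l.
pose A := [seq (j, q) | j <- iota 0 J, q <- good_pairs d (k j) (k j.+1)].
pose U (i : nat * (cmap R * amap R)) : set (R * R) :=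
  let: (j, (S', T)) := i in
  [set z | transl S'.1 <= z.1 <= transl S'.1 + r1 ^+ k j /\
    transl (acomp S'.2 T) <= z.2 <= transl (acomp S'.2 T) + r2 ^+ k j.+1].
exists (nat * (cmap R * amap R))%type, A, U, (fun i => h0 i.1); split.
- move=> [j q]; rewrite /= h0_ge0/= /h0.
  have le : r2 ^+ k j.+1 <= r2 ^+ K2.
    apply: ler_wiXn2l; rewrite ?ltW//; apply: leq_trans (kK0 _).
    by rewrite /K0 ltnW// ltnS leq_maxr.
  rewrite mulrAC ler_pdivrMr// mulrC -ler_pdivlMr//.
  exact: le_trans le HK2.
- move=> [j [S' T]]; apply: diam_le => p q /= [p1 p2] [q1 q2].
  rewrite /h0 -mulrA [r2^-1 * _]mulrC; apply: eucl_dist_le_sup.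
    apply: le_trans (r1k j); rewrite ler_norml.
    by move: p1 q1 => /andP[? ?] /andP[? ?]; apply/andP; split; lra.
  have : r2 ^+ k j.+1 <= r2 ^+ k j.+1 / r2.
    by rewrite ler_pdivlMr// ger_pMr ?exprn_gt0// ltW.
  move: p2 q2 => /andP[? ?] /andP[? ?] ?.
  by rewrite ler_norml; apply/andP; split; lra.
- move=> z Lz; have [P [Pn PS Pz]] := attractor_prefixes L_attractor Lz.
  pose b j := ln (fibre_card G (k j) (P (k j)).2).
  have PT n : (P n).2 \in proj_ifs2 (level G n) by apply/proj_ifs2P; exists (P n).
  have N1 n : 1 <= fibre_card G n (P n).2 by exact: fibre_card_ge1.
  have N0 n : 0 < fibre_card G n (P n).2 by apply: lt_le_trans (N1 n).
  have [|j jJ good] := @exists_good_scale R theta d (ln #|` G|%:R) k b J th0 th1 d0 k0 ks _ BJ.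
    move=> j; rewrite /b ln_ge0//= mulr_natr -lnXn; last first.
      rewrite ltr0n cardfs_gt0; have := level_neq0 1.
      by rewrite /level (words1 (@ccompf1 R)).
    rewrite ler_ln ?posrE ?N0//; last first.
      by apply: lt_le_trans (N0 (k j)) _; rewrite -natrX ler_nat fibre_card_le.
    by rewrite -natrX ler_nat fibre_card_le.
  have [Q Qm PQ] := PS (k j) (k j.+1 - k j)%N.
  rewrite subnKC ?kS// in PQ.
  have PQj : acomp (P (k j)).2 Q.2 = (P (k j.+1)).2 by rewrite PQ.
  have iA : (j, (P (k j), Q.2)) \in A.
    apply/allpairsPdep; exists j, (P (k j), Q.2); split => //.
      by rewrite mem_iota.
    rewrite mem_filter /=; apply/andP; split; last first.
      by apply: allpairs_f => //; apply/proj_ifs2P; exists Q.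
    (* After taking logarithms, goodness of the pair is exactly the inequality [good]. *)
    rewrite PQj -(ler_ln (x := expR _)) ?posrE ?expR_gt0 ?divr_gt0 ?powR_gt0//.
    by rewrite expRK ln_div ?posrE ?powR_gt0// ln_powR.
  exists (index (j, (P (k j), Q.2)) A); first by rewrite index_mem.
  move=> x0; rewrite nth_index// /U PQj.
  have [z1 Lz1 e1] := Pz (k j); have [z2 Lz2 e2] := Pz (k j.+1).
  have [/andP[a1 a2] _] := attractor_sub01 L_normalized Lz1.
  have [_ /andP[b1 b2]] := attractor_sub01 L_normalized Lz2.
  have [c1 _ _ _] := level_bounds L_attractor L_normalized G_homogeneous (Pn (k j)).
  have [_ c2 _ _] := level_bounds L_attractor L_normalized G_homogeneous (Pn (k j.+1)).
  split; apply/andP; split.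
  - by rewrite e1 /ceval/aeval/= c1 lerDr mulr_ge0 ?exprn_ge0 ?(ltW r1_gt0).
  - by rewrite e1 /ceval/aeval/= c1 addrC lerD2l ler_piMr ?exprn_ge0 ?(ltW r1_gt0).
  - by rewrite e2 /ceval/aeval/= c2 lerDr mulr_ge0 ?exprn_ge0 ?(ltW r2_gt0).
  - by rewrite e2 /ceval/aeval/= c2 addrC lerD2l ler_piMr ?exprn_ge0 ?(ltW r2_gt0).
rewrite big_allpairs_dep/=.
apply: (@le_trans _ _ (\sum_(j <- iota 0 J) (e / J.+1%:R))); last first.
  rewrite big_const_seq count_predT size_iota iter_addr_0 -[leLHS]mulr_natr mulrAC.
  by rewrite ler_pdivrMr// ler_pM2l// ler_nat.
apply: ler_sum => j _.
rewrite big_const_seq count_predT iter_addr_0 -[leLHS]mulr_natl.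
have -> : h0 j `^ t = (2 / r2) `^ t * expR ((k j.+1)%:R * (ln r2 * t)).
  rewrite /h0 powRM ?exprn_ge0 ?divr_ge0 ?(ltW r2_gt0)//; congr (_ * _).
  by rewrite -powR_mulrn ?(ltW r2_gt0)// -powRrM /powR gt_eqF// -mulrA [t * _]mulrC.
have sz : (size (good_pairs d (k j) (k j.+1)))%:R <=
    C * expR (d * (k j.+1)%:R) * (M * expR ((k j.+1)%:R / m%:R * ln (Z m))).
  apply: le_trans (HC d _ _ (kS j)) _; rewrite ler_pM2l ?mulr_gt0 ?expR_gt0//.
  by apply: fibre_sum_growth => //; exact: level_neq0.
apply: (@le_trans _ _ (C * expR (d * (k j.+1)%:R) *
    (M * expR ((k j.+1)%:R / m%:R * ln (Z m))) *
    ((2 / r2) `^ t * expR ((k j.+1)%:R * (ln r2 * t))))).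
  by rewrite ler_wpM2r// mulr_ge0 ?powR_ge0 ?expR_ge0.
have -> : C * expR (d * (k j.+1)%:R) *
    (M * expR ((k j.+1)%:R / m%:R * ln (Z m))) *
    ((2 / r2) `^ t * expR ((k j.+1)%:R * (ln r2 * t))) =
  D * (expR (d * (k j.+1)%:R) * expR ((k j.+1)%:R / m%:R * ln (Z m)) *
    expR ((k j.+1)%:R * (ln r2 * t))) by rewrite /D; ring.
rewrite -!expRD.
(* Per unit of [k j.+1] the exponent is [d - a * ln r2 + t * ln r2 = d - 2 * d]. *)
have -> : d * (k j.+1)%:R + (k j.+1)%:R / m%:R * ln (Z m) +
    (k j.+1)%:R * (ln r2 * t) = (k j.+1)%:R * - d.
  by rewrite /d /a; field; rewrite (lt_eqF lnr2) (gt_eqF mR0).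
rewrite expRM_natl mulrC -ler_pdivlMr// -mulrA -invfM.
apply: le_trans HK1; apply: ler_wiXn2l; rewrite ?expR_ge0//.
  by rewrite ltW// expR_lt1 oppr_lt0.
by apply: leq_trans (kK0 _); rewrite /K0 ltnW// ltnS leq_maxl.
Qed.

End upper_bound.

(** * Lower bound *)

(** Greedy selection: keep the head, discard the at most [M] elements near it (itself included), and
    recurse on the far ones. *)
Lemma separated_subseq (R : realType) (T : eqType) (f : T -> R) (d : R)
    (M : nat) (s : seq T) : 0 < d -> uniq s ->
  (forall x, x \in s -> (size [seq y <- s | (`|f x - f y| < d)%R] <= M)%N) ->
  exists s', [/\ uniq s', {subset s' <= s},
    {in s' &, forall x y, x != y -> d <= `|f x - f y|} &
    (size s <= M * size s')%N].
Proof.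
move=> d0; have [n] := ubnP (size s); elim: n s => // n IH [|x s] /=.
  by move=> _ _ _; exists [::]; split.
rewrite ltnS => sn /andP[xs us] sM.
pose far (y : T) : bool := d <= `|f x - f y|.
have [||| s' [us' ss' seps' szs']] := IH [seq y <- s | far y].
- by rewrite size_filter; apply: leq_ltn_trans sn; exact: count_size.
- exact: filter_uniq.
- move=> y; rewrite mem_filter => /andP[_ ys].
  have : (size [seq z <- x :: s | (`|f y - f z| < d)%R] <= M)%N.
    by apply: sM; rewrite inE ys orbT.
  apply: leq_trans; rewrite -filter_predI !size_filter /=.
  apply: leq_trans (leq_addl _ _); apply: sub_count => z /=.
  by case/andP.
exists (x :: s'); split => /=.
- rewrite us' andbT; apply/negP => /ss'; rewrite mem_filter => /andP[_].
  by rewrite (negbTE xs).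
- move=> y; rewrite !inE => /orP[->//|/ss']; rewrite mem_filter => /andP[_ ->].
  by rewrite orbT.
- have sfar y : y \in s' -> far y by move=> /ss'; rewrite mem_filter => /andP[].
  move=> y z; rewrite !inE => /orP[/eqP->|ys'] /orP[/eqP->|zs'].
  + by rewrite eqxx.
  + by move=> _; exact: sfar.
  + by move=> _; rewrite distrC; exact: sfar.
  + exact: seps'.
- rewrite mulnS; have := sM x (mem_head _ _); rewrite /= subrr normr0 d0 /=.
  rewrite !size_filter => le; have {}szs' : (count far s <= M * size s')%N by rewrite -size_filter.
  have : (count (predC far) s <= count (fun y => (`|f x - f y| < d)%R) s)%N.
    by apply: sub_count => y; rewrite /= /far -ltNge.
  have := count_predC far s; move: le szs'; lia.
Qed.

Lemma exists_large_term (R : realType) (J : nat) (x : nat -> R) : (0 < J)%N ->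
  exists2 j, (j < J)%N & \sum_(i < J) x i <= J%:R * x j.
Proof.
case: J => // J _.
have [j _ jmax] := arg_maxP (P := predT) (fun i : 'I_J.+1 => x i) (i0 := ord0) isT.
exists j => //; rewrite mulr_natl -[X in _ *+ X]card_ord -sumr_const.
by apply: ler_sum => i _; exact: jmax.
Qed.

Section lower_bound.
Variables (R : realType) (G : {fset cmap R}) (L : set (R * R)) (r1 r2 : R).
Hypotheses (L_attractor : is_attractor G L) (L_normalized : normalized L)
  (G_homogeneous : homogeneous G r1 r2) (r1_lt_r2 : r1 < r2)
  (r2_lt1 : r2 < 1) (G_rosc : rectangular_osc G)
  (G_wsc : weak_separation (proj_ifs2 G)).

Let r1_gt0 : 0 < r1. Proof. by case: G_homogeneous. Qed.
Let r2_gt0 : 0 < r2. Proof. by case: G_homogeneous. Qed.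
Let r1_lt1 : r1 < 1. Proof. exact: lt_trans r2_lt1. Qed.
Let theta := ln r2 / ln r1.
Let lnr2 : ln r2 < 0. Proof. by rewrite ln_lt0// r2_gt0. Qed.
Let lnr1 : ln r1 < 0. Proof. by rewrite ln_lt0// r1_gt0. Qed.
Let theta_gt0 : 0 < theta.
Proof. exact: (log_ratio_gt0 G_homogeneous r1_lt_r2 r2_lt1). Qed.
Let theta_lt1 : theta < 1.
Proof. exact: (log_ratio_lt1 G_homogeneous r1_lt_r2 r2_lt1). Qed.

Lemma trunc_log_fibre (n : nat) (T : amap R) :
  (trunc_log 2 #|` fibre G n T| < (n * #|` G|).+1)%N.
Proof.
rewrite ltnS -[leqRHS](@trunc_expnK 2)//; apply: leq_trunc_log.
apply: leq_trans (fibre_card_le G n T) _.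
rewrite mulnC expnM; case: n => // n.
by rewrite leq_exp2r// ltnW// ltn_expl.
Qed.

(** Take the dyadic class of fibre sizes with the largest share and thin out its rows by
    [separated_subseq]. The losses are the number of classes, a factor 2 for rounding fibre sizes
    down to [2 ^ j], and the factor [M] of the thinning. *)
Lemma uniform_subsystem : exists2 C : R, 0 < C & forall n : nat,
  exists (j : nat) (s : seq (amap R)),
  [/\ uniq s,
      forall T, T \in s ->
        T \in proj_ifs2 (level G n) /\ (2 ^ j <= #|` fibre G n T|)%N,
      {in s &, forall T T', T != T' -> r2 ^+ n <= `|transl T - transl T'|} &
      fibre_sum G theta n <=
        C * (n * #|` G|).+1%:R * ((size s)%:R * (2 ^ j)%:R `^ theta)].
Proof.
have [e /andP[e0 _] sep] := proj_level_sep L_attractor L_normalized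
  G_homogeneous G_wsc.
(* A window of length [2 * r2 ^+ n] contains at most [M] ordinates that are
   [e * r2 ^+ n]-separated. *)
pose M := Num.truncn (2 / e + 1).
have M0 : (0 < M)%N.
  by rewrite truncn_gt0 lerDr divr_ge0// ltW.
exists (2 * M%:R); first by rewrite mulr_gt0// ltr0n.
move=> n; set J := (n * #|` G|).+1.
have q0 : 0 < r2 ^+ n by rewrite exprn_gt0.
(* Only J dyadic sizes occur, so one of them carries a proportion 1/J of the sum. *)
pose lv T := trunc_log 2 #|` fibre G n T|.
pose A j := [seq T <- proj_ifs2 (level G n) | lv T == j].
pose x j : R := (size (A j))%:R * (2 ^ j.+1)%:R `^ theta.
have [j jJ Zj] := @exists_large_term R J x isT.
have Zx : fibre_sum G theta n <= \sum_(i < J) x i.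
  have -> : fibre_sum G theta n = \sum_(i < J) \sum_(T <- A i) fibre_card G n T `^ theta.
    under [RHS]eq_bigr do rewrite big_filter big_mkcond.
    rewrite exchange_big/=; apply: eq_bigr => T _.
    by rewrite -big_mkcond/= (big_pred1 (Ordinal (trunc_log_fibre n T))).
  apply: ler_sum => i _.
  have -> : x i = \sum_(T <- A i) (2 ^ i.+1)%:R `^ theta.
    by rewrite big_const_seq count_predT iter_addr_0 -[RHS]mulr_natl.
  rewrite big_seq [leRHS]big_seq; apply: ler_sum => T.
  rewrite mem_filter => /andP[/eqP lvT _].
  apply: ge0_ler_powR; rewrite ?nnegrE ?ler0n ?(ltW theta_gt0)//.
  by rewrite /fibre_card ler_nat ltnW// -lvT; exact: trunc_log_ltn.
have uA : uniq (A j) by rewrite filter_uniq ?fset_uniq.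
have [|s [us ss seps szs]] := @separated_subseq R _ (@transl R) (r2 ^+ n) M (A j) q0 uA.
  move=> T TA; rewrite truncn_ge_nat; last by rewrite addr_ge0// divr_ge0// ltW.
  have -> : 2 / e + 1 = (transl T + r2 ^+ n - (transl T - r2 ^+ n)) / (e * r2 ^+ n) + 1.
    by field; rewrite !gt_eqF.
  apply: (@size_separated R _ _ (@transl R)).
  - by rewrite mulr_gt0.
  - lra.
  - by rewrite filter_uniq ?fset_uniq.
  - move=> T'; rewrite mem_filter ltr_norml => /andP[/andP[? ?] _].
    by apply/andP; split; lra.
  - move=> T1 T2; rewrite !mem_filter => /andP[_ /andP[_ T1n]] /andP[_ /andP[_ T2n]].
    exact: sep.
exists j, s; split => //.
- move=> T /ss; rewrite mem_filter => /andP[/eqP lvT Tn]; split => //.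
  rewrite -lvT; apply: trunc_logP => //; have := fibre_card_ge1 Tn.
  by rewrite /fibre_card ler1n.
- apply: (le_trans Zx); apply: (le_trans Zj).
  have x2 : x j <= (M * size s)%:R * (2 * (2 ^ j)%:R `^ theta).
    apply: ler_pM; rewrite ?ler0n ?powR_ge0 ?ler_nat//.
    rewrite expnS natrM powRM ?ler0n//; apply: ler_wpM2r; first exact: powR_ge0.
    by apply: ler1_powR; rewrite ?ler1n// ltW.
  apply: (@le_trans _ _ (J%:R * ((M * size s)%:R * (2 * (2 ^ j)%:R `^ theta)))).
    by rewrite ler_wpM2l ?ler0n.
  by rewrite le_eqVlt; apply/orP; left; apply/eqP; rewrite natrM; ring.
Qed.

(** The subsystem of level [n] has ratios [r1 ^+ n] and [r2 ^+ n], so the uniform criterion applies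
    with exponent [(ln (size s) + theta * ln (2 ^ j)) / - (n * ln r2)], which [Zs] bounds from
    below. *)
Lemma hausdorff_measure_lower : exists2 C : R, 0 < C & forall (n : nat) (t : R),
  (0 < n)%N -> 0 <= t ->
  t < (ln (fibre_sum G theta n) - ln (C * (n * #|` G|).+1%:R)) / - (n%:R * ln r2) ->
  hausdorff_measure t L <> 0%E.
Proof.
have [C C0 HC] := uniform_subsystem; exists C => // n t n0 t0 ts.
have [j [s [us sn seps Zs]]] := HC n.
have [[z0 Lz0] cL _] := L_attractor.
have [z01 z02] := attractor_sub01 L_normalized Lz0.
have Z1 : 1 <= fibre_sum G theta n.
  by apply: fibre_sum_ge1; [exact: ltW|exact: (level_neq0 L_attractor)].
have CJ0 : 0 < C * (n * #|` G|).+1%:R by rewrite mulr_gt0.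
have s0 : (0 < size s)%N.
  rewrite lt0n; apply/negP => /eqP s0; have := le_trans Z1 Zs.
  by rewrite s0 mul0r mulr0 ler10.
have b0 : (0 < 2 ^ j)%N by rewrite expn_gt0.
pose T_ (i : 'I_(size s)) := nth (aid R) s i.
(* Only the first [2 ^ j] maps of each fibre are used, so that all rows have equally many. *)
pose S_ (i : 'I_(size s)) (k : 'I_(2 ^ j)) := nth (cid R) (fibre G n (T_ i)) k.
have Ts i : T_ i \in s by rewrite mem_nth.
have Tn i : T_ i \in proj_ifs2 (level G n) by have [] := sn _ (Ts i).
have Sn i k : S_ i k \in level G n /\ (S_ i k).2 = T_ i.
  have : S_ i k \in fibre G n (T_ i).
    by apply: mem_nth; apply: leq_trans (ltn_ord k) _; have [] := sn _ (Ts i).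
  by rewrite mem_fibre => /andP[? /eqP].
have bnd := level_bounds L_attractor L_normalized G_homogeneous.
apply: (@hausdorff_measure_uniform_neq0 R 'I_(size s) 'I_(2 ^ j)
  (r1 ^+ n) (r2 ^+ n) (fun i k => transl (S_ i k).1) (fun i => transl (T_ i)) L z0).
- by rewrite exprn_gt0// exprn_ilt1 ?ltW// -lt0n.
- by rewrite exprn_gt0// exprn_ilt1 ?ltW// -lt0n.
- by rewrite card_ord.
- by rewrite card_ord.
- by move=> i k; have [Sik _] := Sn i k; have [_ _ ? _] := bnd _ _ Sik.
- by move=> i; have [k Sk ->] := proj_ifs2P _ _ (Tn i); have [_ _ _ ?] := bnd _ _ Sk.
- move=> i k k' kk'; have [S1 e1] := Sn i k; have [S2 e2] := Sn i k'.
  apply: (level_fibre_sep L_attractor L_normalized G_homogeneous G_rosc S1 S2).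
    by rewrite e1 e2.
  rewrite nth_uniq ?fset_uniq//.
    by apply: leq_trans (ltn_ord k) _; have [] := sn _ (Ts i).
  by apply: leq_trans (ltn_ord k') _; have [] := sn _ (Ts i).
- move=> i i' ii'; apply: seps => //; rewrite nth_uniq//.
- exact: cL.
- exact: Lz0.
- exact: z01.
- exact: z02.
- move=> z i k Lz; have [Sik e] := Sn i k; have [a1 a2 _ _] := bnd _ _ Sik.
  have := level_attractor L_attractor Sik Lz.
  by rewrite /ceval/aeval/= a1 a2 e.
- exact: t0.
rewrite !card_ord; apply: (lt_le_trans ts).
have nR0 : 0 < n%:R :> R by rewrite ltr0n.
have -> : ln (size s)%:R / - ln (r2 ^+ n) + ln (2 ^ j)%:R / - ln (r1 ^+ n) =
    (ln (size s)%:R + theta * ln (2 ^ j)%:R) / - (n%:R * ln r2).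
  rewrite !lnXn// -!(mulr_natr (ln _)) /theta; field.
  by rewrite (lt_eqF lnr1) (lt_eqF lnr2) (gt_eqF nR0).
rewrite ler_pM2r ?invr_gt0 ?oppr_gt0 ?pmulr_rlt0//.
have sR0 : 0 < (size s)%:R :> R by rewrite ltr0n.
have bR0 : 0 < (2 ^ j)%:R :> R by rewrite ltr0n.
rewrite lerBlDl -[theta * _]ln_powR -!lnM ?posrE ?mulr_gt0 ?powR_gt0//.
rewrite ler_ln ?posrE ?mulr_gt0 ?powR_gt0//.
exact: lt_le_trans Z1.
Qed.

End lower_bound.

(** * Convergence *)

(** The exponential of [x = n * e] exceeds [x ^+ 2 / 2], and from [n >= D] on this exceeds
    [C * (g + 1) * n]. *)
Lemma near_ln_affine_le (R : realType) (C e : R) (g : nat) : 0 < C -> 0 < e ->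
  \forall n \near \oo, ln (C * (n * g).+1%:R) <= n%:R * e.
Proof.
move=> C0 e0; pose D := 2 * (C * g.+1%:R) / e ^+ 2.
exists (Num.truncn D).+1 => // n /= nD.
have n0 : (0 < n)%N by apply: leq_trans nD.
have nR0 : 0 < n%:R :> R by rewrite ltr0n.
have Dn : D <= n%:R.
  by rewrite ltW// (lt_le_trans (truncnS_gt D))// ler_nat.
have CJ0 : 0 < C * (n * g).+1%:R by rewrite mulr_gt0.
rewrite -[leRHS]expRK ler_ln ?posrE ?expR_gt0//.
have ne0 : 0 <= n%:R * e by rewrite mulr_ge0// ltW.
apply: le_trans (expR_ge1Dxn 1 ne0).
have le1 : C * (n * g).+1%:R <= C * g.+1%:R * n%:R.
  by rewrite -mulrA ler_pM2l// -natrM ler_nat mulSn mulnC -addn1 addnC leq_add2r.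
have le2 : C * g.+1%:R * n%:R <= (n%:R * e) ^+ 2 / 2.
  have -> : (n%:R * e) ^+ 2 / 2 = n%:R * (e ^+ 2 / 2) * n%:R by field.
  rewrite ler_pM2r// -ler_pdivrMr ?divr_gt0 ?exprn_gt0//.
  apply: le_trans Dn; rewrite le_eqVlt; apply/orP; left; apply/eqP.
  by rewrite /D; field; rewrite gt_eqF.
by apply: (le_trans le1); apply: (le_trans le2); rewrite lerDr.
Qed.

Theorem corollary1p2 (R : realType) (G : {fset cmap R}) (L : set (R * R))
    (r1 r2 : R)
    (G_carpet : self_affine_carpet G)
    (L_attractor : is_attractor G L)
    (L_normalized : normalized L)
    (G_homogeneous : homogeneous G r1 r2)
    (G_orientation : orientation_preserving G)
    (r1_gt0 : 0 < r1) (r1_lt_r2 : r1 < r2) (r2_lt1 : r2 < 1)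
    (G_rosc : rectangular_osc G)
    (G_wsc : weak_separation (proj_ifs2 G)) :
  (fun n : nat =>
    (ln (\sum_(T <- proj_ifs2 (level G n))
           (#|` [fset S in level G n | S.2 == T]|%:R : R) `^ (ln r2 / ln r1))
     / - (n%:R * ln r2))%:E) @ \oo --> hausdorff_dim L.
Proof.
pose a n := ln (fibre_sum G (ln r2 / ln r1) n) / - (n%:R * ln r2).
change ((fun n => (a n)%:E) @ \oo --> hausdorff_dim L).
have r2_gt0 : 0 < r2 by case: G_homogeneous.
have lnr2 : ln r2 < 0 by rewrite ln_lt0// r2_gt0.
have [C C0 low] := hausdorff_measure_lower L_attractor L_normalized
  G_homogeneous r1_lt_r2 r2_lt1 G_rosc G_wsc.
(* The loss of the lower bound: the dimension is squeezed between [a n - e n] and [a n], and [e n]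
   tends to 0. *)
pose e n := ln (C * (n * #|` G|).+1%:R) / - (n%:R * ln r2).
have a_ge0 n : 0 <= a n.
  rewrite divr_ge0 ?ln_ge0//; last by rewrite oppr_ge0 mulr_ge0_le0// ltW.
  apply: fibre_sum_ge1; last exact: (level_neq0 L_attractor).
  exact: ltW (log_ratio_gt0 G_homogeneous r1_lt_r2 r2_lt1).
have upper n : (0 < n)%N -> (hausdorff_dim L <= (a n)%:E)%E.
  move=> n0; apply/lee_addgt0Pr => d d0; apply: ereal_inf_lbound.
  exists (a n + d) => //; split; first by rewrite addr_ge0// ltW.
  by apply: (hausdorff_measure_upper L_attractor L_normalized G_homogeneous
    r1_lt_r2 r2_lt1 G_wsc n0); rewrite ltrDl.
have lower n : (0 < n)%N -> ((a n - e n)%:E <= hausdorff_dim L)%E.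
  move=> n0; apply: le_ereal_inf_tmp => _ [t [t0 Ht] <-].
  rewrite lee_fin leNgt; apply/negP => lt; apply: (low n t n0 t0 _ Ht).
  by rewrite mulrBl.
(* The bounds at [n = 1] already make the dimension finite. *)
have [D DE] : exists D, hausdorff_dim L = D%:E.
  have := upper 1%N isT; have := lower 1%N isT.
  by case: (hausdorff_dim L) => [D||]// _ _; exists D.
rewrite DE; apply/fine_cvgP; split; first exact: nearW.
apply/cvgrPdist_le => eps eps0.
have le0 : 0 < eps * - ln r2 by rewrite mulr_gt0// oppr_gt0.
near=> n.
have n0 : (0 < n)%N by near: n; exists 1%N.
have := upper n n0; have := lower n n0; rewrite DE !lee_fin => lo up.
rewrite /= distrC ger0_norm ?subr_ge0// lerBlDl.
suff : e n <= eps by move: lo; lra.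
rewrite /e ler_pdivrMr; last by rewrite oppr_gt0 pmulr_rlt0 ?ltr0n.
have -> : eps * - (n%:R * ln r2) = n%:R * (eps * - ln r2) by ring.
by near: n; exact: near_ln_affine_le.
Unshelve. all: by end_near.
Qed.
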